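(* Let $d\ge1$ be an integer. For all density matrices $\rho,\sigma\in\mathcal{D}(\mathbb{C}^d)$ and every $a\in[0,1]$: (i) for every $\alpha\in[0,1)$, the Rényi entropy of order $\alpha$ satisfies $H_\alpha(\rho\boxplus_a\sigma)\ge a H_\alpha(\rho)+(1-a)H_\alpha(\sigma)$; (ii) the subentropy satisfies $Q(\rho\boxplus_a\sigma)\ge a Q(\rho)+(1-a)Q(\sigma)$.
   Context: $\mathcal{D}(\mathbb{C}^d)$ is the set of $d\times d$ complex positive semidefinite matrices of trace $1$. $\log$ is the natural logarithm. Rényi entropy of order $\alpha\in[0,1)$: $H_\alpha(\rho):=\frac{1}{1-\alpha}\log(\operatorname{Tr}\rho^\alpha)$ (for $\alpha=0$, $\operatorname{Tr}\rho^0$ is the rank of $\rho$). Subentropy: if $\rho$ has eigenvalues $\lambda_1,\dots,\lambda_d$ that are distinct and positive, $$Q(\rho):=-\sum_{i=1}^d\frac{\lambda_i^d}{\prod_{j\ne i}(\lambda_i-\lambda_j)}\log\lambda_i ;$$ if some eigenvalues coincide or are zero, $Q(\rho)$ is defined as the corresponding limit of this expression, which always exists and is finite. Addition rule: $\rho\boxplus_a\sigma:=a\rho+(1-a)\sigma-\sqrt{a(1-a)}\;i[\rho,\sigma]$, with $[\rho,\sigma]:=\rho\sigma-\sigma\rho$. This is again a density matrix: it equals $\operatorname{Tr}_2\big(U_a(\rho\otimes\sigma)U_a^\dagger\big)$, where $U_a=\sqrt a\,I+i\sqrt{1-a}\,S$ and $S$ is the swap operator on $\mathbb{C}^d\otimes\mathbb{C}^d$.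 *)

(* Defs.v *)
From HB Require Import structures.
From mathcomp Require Import all_boot all_order all_algebra.
From mathcomp Require Import complex.
From mathcomp Require Import all_classical all_reals all_analysis.

Set Implicit Arguments.
Unset Strict Implicit.
Unset Printing Implicit Defensive.

Import Order.TTheory GRing.Theory Num.Theory.
Import numFieldNormedType.Exports.

Local Open Scope classical_set_scope.
Local Open Scope ring_scope.
Local Open Scope complex_scope.
Local Open Scope sesquilinear_scope.

(* [^t*] is the conjugate transpose; [0 <= z] in [R[i]] means that [z] is
   real and nonnegative. *)
Definition psdmx (R : realType) (d : nat) (A : 'M[R[i]]_d) : Prop :=
  A \is hermsymmx /\
  forall v : 'cV[R[i]]_d, 0 <= (v ^t* *m A *m v) ord0 ord0.

Definition density (R : realType) (d : nat) (rho : 'M[R[i]]_d) : Prop :=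
  psdmx rho /\ \tr rho = 1.

(* Eigenvalues listed with multiplicity. Meaningful for Hermitian matrices:
   the entries of [spectral_diag A] are then real, so [Re] loses nothing. *)
Definition eigvals (R : realType) (d : nat) (A : 'M[R[i]]_d) : 'rV[R]_d :=
  map_mx (@complex.Re R) (spectral_diag A).

(* Functional calculus: [spectralmx A] is unitary, and for Hermitian [A]
   [A = invmx P *m diag_mx (spectral_diag A) *m P] with [P := spectralmx A]
   ([orthomx_spectralP]). *)
Definition mxfun (R : realType) (d : nat) (f : R -> R) (A : 'M[R[i]]_d) :
    'M[R[i]]_d :=
  invmx (spectralmx A)
    *m diag_mx (map_mx (fun x : R => (f x)%:C) (eigvals A))
    *m spectralmx A.

(* The case [alpha = 0] is separate because [0 `^ 0 = 1] for [powR], which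
   would give [d] instead of the rank. For [alpha != 0], [0 `^ alpha = 0]. *)
Definition trace_pow (R : realType) (d : nat) (alpha : R) (rho : 'M[R[i]]_d) :
    R :=
  if alpha == 0 then (\rank rho)%:R
  else complex.Re (\tr (mxfun (fun x : R => x `^ alpha) rho)).

Definition renyi (R : realType) (d : nat) (alpha : R) (rho : 'M[R[i]]_d) : R :=
  (1 - alpha)^-1 * ln (trace_pow alpha rho).

Definition distinct_pos (R : realType) (d : nat) : set 'rV[R]_d :=
  [set l | injective (fun i => l ord0 i) /\ forall i, 0 < l ord0 i].

Definition subentropy_formula (R : realType) (d : nat) (l : 'rV[R]_d) : R :=
  - \sum_(i < d)
      l ord0 i ^+ d / (\prod_(j < d | j != i) (l ord0 i - l ord0 j))
        * ln (l ord0 i).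

(* The limit is over vectors of distinct positive reals tending to [l]. *)
Definition subentropy_vec (R : realType) (d : nat) (l : 'rV[R]_d) : R :=
  if `[< distinct_pos l >] then subentropy_formula l
  else lim (@subentropy_formula R d @ within (@distinct_pos R d) (nbhs l)).

Definition subentropy (R : realType) (d : nat) (rho : 'M[R[i]]_d) : R :=
  subentropy_vec (eigvals rho).

Definition boxplus (R : realType) (d : nat) (a : R) (rho sigma : 'M[R[i]]_d) :
    'M[R[i]]_d :=
  a%:C *: rho + (1 - a)%:C *: sigma
    - ((Num.sqrt (a * (1 - a)))%:C * 'i%C) *: (rho *m sigma - sigma *m rho).

(* Main.v *)
(** The heart of the matter is the majorization of the spectrum of
    [rho [+]_a sigma] by [a lambda + (1 - a) mu], where [lambda] and [mu] are the
    decreasingly ordered spectra of [rho] and [sigma].  The form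
    [Y(A, B) = a tr(B) A + b tr(A) B - i s [A, B]], with [b = 1 - a] and
    [s^2 = a b], is bilinear, so writing both states as positive combinations of
    the projections of their spectral flags reduces Ky Fan's inequalities to
    projections [P], [Q] of ranks [j], [l]: for a projection [Pi] of rank [k],
    [tr(Pi Y(P, Q)) <= a l min(k, j) + b j min(k, l)].
    If [k >= j, l] this is [Y >= 0]; if [k <= j, l] it is positivity of the same
    form at the complementary projections; if [j <= k <= l], it holds because
    [Q Y Q >= b j Q], the commutator being killed by the compression.

    Majorization gives [F (a lambda + (1 - a) mu) <= F (spectrum of the sum)] for
    every symmetric concave [F].  For Rényi entropies, [F] is a sum of concave
    functions of one variable.  Partial fractions turn the subentropy into
    [int_0^oo (1 - prod_i t / (t + l_i) - (sum_i l_i) / (1 + t)) dt],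
    whose truncations are concave because [prod_i t / (t + l_i)] is log-convex;
    uniform error bounds give the continuous extension to the boundary. *)

Require Import Defs.
From mathcomp Require Import all_boot all_order all_algebra all_fingroup.
From mathcomp Require Import ring lra zify complex.
From mathcomp Require Import all_classical all_reals all_analysis.

Set Implicit Arguments.
Unset Strict Implicit.
Unset Printing Implicit Defensive.

Import Order.TTheory GRing.Theory Num.Theory.
Import numFieldNormedType.Exports.

Local Open Scope ring_scope.

(** * Two projections *)

Section Projections.
Local Open Scope sesquilinear_scope.
Variables (C : numClosedFieldType) (n : nat).
Implicit Types (A B P Q K : 'M[C]_n) (u v : 'rV[C]_n).
Local Notation "''[' u , v ]" := (dotmx u v).
Local Notation "''[' u ]" := (dotmx u u).

(** Transfers an inequality to one with the same difference of sides, leaving only an identity for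
    [ring]. *)
Lemma le_subW (x y x' y' : C) : y - x = y' - x' -> x <= y -> x' <= y'.
Proof. by rewrite -subr_ge0 => ->; rewrite subr_ge0. Qed.

Lemma adj_mulmx m p q (A : 'M[C]_(m, p)) (B : 'M[C]_(p, q)) :
  (A *m B) ^t* = B ^t* *m A ^t*.
Proof. by rewrite trmx_mul map_mxM. Qed.

(** Vectors are rows here. Since [0 <= z] forces [z] to be real, no separate Hermitian condition is
    imposed. *)
Definition psd A := forall v, 0 <= (v *m A *m v ^t*) 0 0.

(** Cancelling the full-rank factors of [P = col_base P *m row_base P] in [P *m P = P] leaves
    [row_base P *m col_base P = 1], whose size is the rank. *)
Lemma tr_idempotent P : P *m P = P -> \tr P = (\rank P)%:R.
Proof.
move=> iP; have /row_full_inj cinj := col_base_full P.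
have /row_free_inj rinj := row_base_free P.
have rc : row_base P *m col_base P = 1%:M.
  apply: cinj; apply: rinj.
  by rewrite mulmx1 mulmxA mulmx_base -mulmxA mulmx_base.
by rewrite -{1}(mulmx_base P) mxtrace_mulC rc mxtrace1.
Qed.

Definition oproj P := P ^t* = P /\ P *m P = P.

Lemma oprojC P : oproj P -> oproj (1%:M - P).
Proof.
case=> hP iP; split; first by rewrite linearB /= map_mxB trmx1 map_mx1 hP.
by rewrite mulmxBr mulmx1 mulmxBl mul1mx iP subrr subr0.
Qed.

Lemma adj_form P Q v : Q ^t* = Q ->
  (v *m (P *m Q) *m v ^t*) 0 0 = '[v *m P, v *m Q].
Proof. by move=> hQ; rewrite dotmxE adj_mulmx hQ !mulmxA. Qed.

Lemma oproj_form P v : oproj P -> (v *m P *m v ^t*) 0 0 = '[v *m P].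
Proof. by case=> hP iP; rewrite -{1}iP adj_form. Qed.

(** By cyclicity the trace is that of [P *m A *m P ^t*], whose diagonal entries are values of the
    form of [A] at the rows of [P]. *)
Lemma tr_oproj_psd P A : oproj P -> psd A -> 0 <= \tr (P *m A).
Proof.
case=> hP iP psdA; rewrite -iP -mulmxA mxtrace_mulC -{2}hP.
apply: sumr_ge0 => i _.
rewrite [X in 0 <= X](_ : _ = (row i P *m A *m (row i P) ^t*) 0 0) //.
by rewrite -row_mul [LHS]mxE [RHS]mxE; apply: eq_bigr => j _; rewrite !mxE.
Qed.

(* [x] times the form is [| x v P - s i v Q |^2 + (x y - s^2) | v Q |^2]. *)
Lemma psd_two_oproj P Q (x y s : C) : oproj P -> oproj Q -> 0 <= x -> 0 <= y ->
  s \is Num.real -> s ^+ 2 <= x * y ->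
  psd (x *: P + y *: Q + (s * 'i) *: (P *m Q - Q *m P)).
Proof.
move=> oP oQ x0 y0 sR sxy v; have [hP _] := oP; have [hQ _] := oQ.
have -> : (v *m (x *: P + y *: Q + (s * 'i) *: (P *m Q - Q *m P)) *m v ^t*) 0 0
  = x * '[v *m P] + y * '[v *m Q]
    + (s * 'i) * ('[v *m P, v *m Q] - '[v *m Q, v *m P]).
  rewrite -!oproj_form// -!adj_form//.
  rewrite !mulmxDr !mulmxDl -!scalemxAr -!scalemxAl mulmxBr mulmxBl.
  by rewrite !mxE.
set p := v *m P; set q := v *m Q.
(* The square is completed after multiplying by [x]; when [x = 0] the discriminant condition forces
   [s = 0]. *)
have [x_eq0|x_neq0] := eqVneq x 0.
  move: sxy; rewrite x_eq0 mul0r real_exprn_even_le0// => /eqP ->.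
  by rewrite !mul0r add0r addr0 mulr_ge0 ?dnorm_ge0.
have xgt0 : 0 < x by rewrite lt_def x_neq0.
rewrite -(pmulr_rge0 _ xgt0).
have -> : x * (x * '[p] + y * '[q] + s * 'i * ('[p, q] - '[q, p])) =
  '[x *: p - (s * 'i) *: q] + (x * y - s ^+ 2) * '[q].
  rewrite linearBl/= !linearBr/= !linearZl/= !linearZr/= rmorphM /= conjCi.
  rewrite (CrealP sR) (CrealP (ger0_real x0)).
  have ii : 'i * 'i = -1 :> C by rewrite -expr2 sqrCi.
  by rewrite /GRing.scale /=; ring: ii.
by rewrite addr_ge0 ?dnorm_ge0// mulr_ge0 ?dnorm_ge0// subr_ge0.
Qed.

Lemma oproj_sub P (m : nat) (B : 'M[C]_(m, n)) :
  oproj P -> (B <= P)%MS -> B *m P = B.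
Proof. by case=> _ iP /submxP[D ->]; rewrite -mulmxA iP. Qed.

(** [T] is the projection [B ^t* *m B] onto the intersection of the row spaces, [B] being an
    orthonormal basis obtained by Gram-Schmidt. *)
Lemma oproj_cap P Q : oproj P -> oproj Q -> exists T,
  [/\ oproj T, T *m P = T, T *m Q = T & \tr T = (\rank (P :&: Q)%MS)%:R].
Proof.
move=> oP oQ; pose W := row_base (P :&: Q)%MS; pose B := schmidt W.
have BW : (B :=: W)%MS by exact/eqmx_schmidt_free/row_base_free.
have BPQ : (B <= P :&: Q)%MS by rewrite BW eq_row_base.
have BB : B *m B ^t* = 1%:M.
  by apply/unitarymxP/schmidt_unitarymx; rewrite rank_leq_col.
exists (B ^t* *m B); split.
- split; first by rewrite adj_mulmx trmxCK.
  by rewrite mulmxA -[_ *m B *m _]mulmxA BB mulmx1.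
- by rewrite -mulmxA (oproj_sub oP) // (submx_trans BPQ) // capmxSl.
- by rewrite -mulmxA (oproj_sub oQ) // (submx_trans BPQ) // capmxSr.
- by rewrite mxtrace_mulC BB mxtrace1.
Qed.

Lemma oproj_rankC P : (n <= \rank P + \rank (1%:M - P)%R)%N.
Proof.
by have := mxrank_add (1%:M - P) P; rewrite subrK mxrank1 addnC.
Qed.

Lemma oproj_subset P T : oproj P -> oproj T -> T *m P = T -> oproj (P - T).
Proof.
move=> [hP iP] [hT iT] TP; split; first by rewrite linearB /= map_mxB hP hT.
have PT : P *m T = T by have := congr1 (fun X => X ^t*) TP; rewrite adj_mulmx hP hT.
by rewrite mulmxBr !mulmxBl iP TP PT iT subrr subr0.
Qed.

Definition commutator A B := A *m B - B *m A.

(** Lets positivity at the complementary projections bound the original form from above. *)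
Lemma commutatorC P Q :
  commutator (1%:M - P) (1%:M - Q) = commutator P Q.
Proof.
rewrite /commutator !mulmxBl !mulmxBr !mulmx1 !mul1mx.
by move: (P *m Q) (Q *m P) => X Y; apply/matrixP => i j; rewrite !mxE; ring.
Qed.

Lemma oproj_psd P : oproj P -> psd P.
Proof. by move=> oP v; rewrite oproj_form// dnorm_ge0. Qed.

Lemma psd_two_oprojB P Q (x y s : C) : oproj P -> oproj Q -> 0 <= x -> 0 <= y ->
  s \is Num.real -> s ^+ 2 <= x * y ->
  psd (x *: P + y *: Q - (s * 'i) *: commutator P Q).
Proof.
move=> oP oQ x0 y0 sR sxy; rewrite -scaleNr -mulNr.
by apply: psd_two_oproj; rewrite ?rpredN ?sqrrN.
Qed.

(* On the range of [Q] the commutator vanishes, so there the form is at least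
   [y]; compress to the intersection of that range with the kernel of [Pi]. *)
Lemma tr_oprojC_two_oproj P Q Pi (x y s : C) :
  oproj P -> oproj Q -> oproj Pi -> 0 <= x -> 0 <= y ->
  s \is Num.real -> s ^+ 2 <= x * y ->
  y * (\rank Q - \rank Pi)%N%:R <=
  \tr ((1%:M - Pi) *m (x *: P + y *: Q - (s * 'i) *: commutator P Q)).
Proof.
move=> oP oQ oPi x0 y0 sR sxy.
have psdY := psd_two_oprojB oP oQ x0 y0 sR sxy.
set Y := _ - _ in psdY *.
have [T [oT TPi TQ trT]] := oproj_cap (oprojC oPi) oQ.
rewrite -{1}[1%:M - Pi](subrK T) mulmxDl raddfD /=.
rewrite -[leLHS]add0r lerD ?tr_oproj_psd//.
  exact: oproj_subset (oprojC oPi) oT TPi.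
have QT : Q *m T = T.
  by have := congr1 (fun X => X ^t*) TQ; rewrite adj_mulmx oQ.1 oT.1.
have -> : \tr (T *m Y) = x * \tr (T *m P) + y * \tr T.
  rewrite /Y /commutator !(mulmxBr, mulmxDr) -!scalemxAr !raddfD /= !raddfN /=.
  (* Cyclicity with [Q *m T = T = T *m Q] gives both halves of the commutator the trace of [T *m P],
     so they cancel. *)
  have TPQ : \tr (T *m (P *m Q)) = \tr (T *m P).
    by rewrite mulmxA mxtrace_mulC mulmxA QT.
  by rewrite !mxtraceZ TPQ [T *m (Q *m P)]mulmxA TQ subrr addr0.
rewrite -[leLHS]add0r lerD ?mulr_ge0// ?tr_oproj_psd//; first exact: oproj_psd.
(* Dimension count: the range of [1 - Pi] has dimension at least [n - \rank Pi], so it meets that of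
   [Q] in dimension at least [\rank Q - \rank Pi]. *)
rewrite ler_wpM2l// trT ler_nat.
have := mxrank_sum_cap (1%:M - Pi) Q; have := oproj_rankC Pi.
have := rank_leq_row (1%:M - Pi + Q)%MS.
lia.
Qed.

Lemma tr_two_oproj P Q Pi (a b s : C) :
  oproj P -> oproj Q -> oproj Pi -> 0 <= a -> 0 <= b -> a + b = 1 ->
  s \is Num.real -> s ^+ 2 <= a * b ->
  \tr (Pi *m ((a * \tr Q) *: P + (b * \tr P) *: Q - (s * 'i) *: commutator P Q))
  <= a * \tr Q * (minn (\rank Pi) (\rank P))%:R
     + b * \tr P * (minn (\rank Pi) (\rank Q))%:R.
Proof.
move=> oP oQ oPi a0 b0 ab sR sab.
have trP := tr_idempotent oP.2; have trQ := tr_idempotent oQ.2.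
have trPi := tr_idempotent oPi.2.
set k := \rank Pi; set j := \rank P; set l := \rank Q.
(* Zero projections are set aside so that [\tr P * \tr Q >= 1], which turns [s ^+ 2 <= a * b] into
   the discriminant condition for the trace-weighted form. *)
have [P0|Pn0] := eqVneq j 0%N.
  have /eqP -> : P == 0 by rewrite -mxrank_eq0 -/j P0.
  rewrite /commutator mul0mx mulmx0 subrr !scaler0 mxtrace0 mulr0 scale0r.
  by rewrite add0r subr0 mulmx0 mxtrace0 mul0r addr0 trQ !mulr_ge0.
have [Q0|Qn0] := eqVneq l 0%N.
  have /eqP -> : Q == 0 by rewrite -mxrank_eq0 -/l Q0.
  rewrite /commutator mul0mx mulmx0 subrr !scaler0 mxtrace0 mulr0 scale0r.
  by rewrite add0r subr0 mulmx0 mxtrace0 mul0r add0r trP !mulr_ge0.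
have x0 : 0 <= a * \tr Q by rewrite trQ mulr_ge0.
have y0 : 0 <= b * \tr P by rewrite trP mulr_ge0.
have sxy : s ^+ 2 <= (a * \tr Q) * (b * \tr P).
  rewrite mulrACA (le_trans sab)// ler_peMr ?mulr_ge0// trP trQ -natrM.
  by rewrite ler1n muln_gt0 !lt0n Qn0 Pn0.
have psdY := psd_two_oprojB oP oQ x0 y0 sR sxy.
set Y := _ - _ in psdY *.
have trY : \tr Y = \tr P * \tr Q.
  rewrite /Y /commutator !raddfD /= !raddfN /= !mxtraceZ.
  rewrite [\tr (P *m Q)]mxtrace_mulC subrr addr0.
  by rewrite -mulrA -[b * _ * _]mulrA [\tr Q * _]mulrC -mulrDl ab mul1r.
have trPiY : \tr (Pi *m Y) = \tr Y - \tr ((1%:M - Pi) *m Y).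
  rewrite mulmxBl mul1mx; have -> : \tr (Y - Pi *m Y) = \tr Y - \tr (Pi *m Y).
    exact: raddfB.
  by rewrite subKr.
have trE : \tr P * \tr Q = a * \tr Q * \tr P + b * \tr P * \tr Q.
  by rewrite -[LHS]mul1r -ab; ring.
(* If [j, l <= k] the bound is the whole trace of [Y]; if [j <= k < l] the part on [1 - Pi] accounts
   for the excess [b j (l - k)]. *)
have [jk|kj] := leqP j k; have [lk|kl] := leqP l k.
- rewrite trPiY trY trE -trP -trQ gerBl.
  exact: tr_oproj_psd (oprojC oPi) psdY.
- have := tr_oprojC_two_oproj oP oQ oPi x0 y0 sR sxy.
  rewrite -/Y -/k -/l trPiY trY trE natrB 1?ltnW// trQ trP.
  by apply: le_subW; rewrite /j /l; ring.
(* Exchanging [P] and [Q] reverses the commutator, hence the sign of [s]. *)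
- have sR' : - s \is Num.real by rewrite rpredN.
  have syx : (- s) ^+ 2 <= (b * \tr P) * (a * \tr Q) by rewrite sqrrN mulrC.
  have := tr_oprojC_two_oproj oQ oP oPi y0 x0 sR' syx.
  have -> : (b * \tr P) *: Q + (a * \tr Q) *: P - (- s * 'i) *: commutator Q P = Y.
    by rewrite /Y /commutator -[Q *m P - _]opprB mulNr scaleNr scalerN opprK
      [X in X - _]addrC.
  rewrite -/k -/j trPiY trY trE natrB 1?ltnW// trQ trP.
  by apply: le_subW; rewrite /j /l; ring.
(* For [k < j, l], positivity at the complements says that [Y] is at most [a \tr Q + b \tr P] times
   the identity. *)
- have sR' : - s \is Num.real by rewrite rpredN.
  have sxy' : (- s) ^+ 2 <= (a * \tr Q) * (b * \tr P) by rewrite sqrrN.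
  have := psd_two_oprojB (oprojC oP) (oprojC oQ) x0 y0 sR' sxy'.
  rewrite commutatorC.
  have -> : (a * \tr Q) *: (1%:M - P) + (b * \tr P) *: (1%:M - Q)
      - (- s * 'i) *: commutator P Q = (a * \tr Q + b * \tr P) *: 1%:M - Y.
    by rewrite /Y; move: (commutator _ _) => Z; apply/matrixP => i i';
      rewrite !mxE; ring.
  move/(tr_oproj_psd oPi); rewrite mulmxBr -scalemxAr mulmx1 [X in 0 <= X]raddfB.
  by rewrite /= mxtraceZ subr_ge0 trPi mulrDl.
Qed.

End Projections.

(** * Spectral flags *)

Section Flags.
Local Open Scope sesquilinear_scope.
Variables (C : numClosedFieldType) (n : nat).
Implicit Types (A B P Q U V : 'M[C]_n).

Definition udiag U (x : 'I_n -> C) : 'M[C]_n :=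
  U ^t* *m diag_mx (\row_i x i) *m U.

(** The projection onto the span of the first [m] rows of [U], which are eigenvectors of every
    [udiag U x]. *)
Definition flag U (m : nat) : 'M[C]_n := udiag U (fun i => (i < m)%:R).

Lemma udiag_mul U x y : U \is unitarymx ->
  udiag U x *m udiag U y = udiag U (fun i => x i * y i).
Proof.
move=> /unitarymxP uU; rewrite /udiag !mulmxA -[_ *m U *m _]mulmxA uU mulmx1.
rewrite -[_ *m diag_mx _ *m diag_mx _]mulmxA mulmx_diag; congr (_ *m diag_mx _ *m _).
by apply/rowP => i; rewrite !mxE.
Qed.

Lemma tr_udiag U x : U \is unitarymx -> \tr (udiag U x) = \sum_i x i.
Proof.
move=> /unitarymxP uU; rewrite /udiag -mulmxA mxtrace_mulC -mulmxA uU mulmx1.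
by rewrite mxtrace_diag; apply: eq_bigr => i _; rewrite mxE.
Qed.

Lemma sum_udiag U (I : Type) (r : seq I) (p : I -> C) (x : I -> 'I_n -> C) :
  \sum_(m <- r) p m *: udiag U (x m) =
  udiag U (fun i => \sum_(m <- r) p m * x m i).
Proof.
rewrite /udiag; under eq_bigr do rewrite scalemxAl scalemxAr.
rewrite -mulmx_suml -mulmx_sumr; congr (_ *m _ *m _).
apply/matrixP => i j; rewrite !mxE summxE -sumrMnl.
by apply: eq_bigr => m _; rewrite !mxE mulrnAr.
Qed.

Lemma eq_udiag U x y : x =1 y -> udiag U x = udiag U y.
Proof. by move=> xy; congr (_ *m diag_mx _ *m _); apply/rowP => i; rewrite !mxE xy. Qed.

Lemma oproj_udiag_nat U (b : 'I_n -> bool) : U \is unitarymx ->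
  oproj (udiag U (fun i => (b i)%:R)).
Proof.
move=> uU; split.
  rewrite /udiag !adj_mulmx trmxCK mulmxA; congr (_ *m _ *m _).
  by apply/matrixP => i j; rewrite !mxE rmorphMn /= rmorph_nat eq_sym;
    case: eqVneq => [->|].
rewrite udiag_mul//; apply: eq_udiag => i.
by case: (b i); rewrite ?mulr1 ?mulr0.
Qed.

(** Replacing zero entries by [1] gives an invertible factor; what remains is a projection, whose
    rank is its trace. *)
Lemma rank_udiag U x : U \is unitarymx ->
  \rank (udiag U x) = #|[pred i | x i != 0]|.
Proof.
move=> uU; pose b i := x i != 0; pose y i := if b i then x i else 1.
have -> : udiag U x = udiag U (fun i => (b i)%:R) *m udiag U y.
  rewrite udiag_mul//; apply: eq_udiag => i; rewrite /y /b.
  by case: eqVneq => [->|_]; rewrite ?mul0r ?mul1r.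
have uy : udiag U y \in unitmx.
  have /mulmx1_unit[]// : udiag U y *m udiag U (fun i => (y i)^-1) = 1%:M.
  rewrite udiag_mul// (@eq_udiag _ _ (fun=> 1)).
    rewrite /udiag (_ : diag_mx _ = 1%:M).
      rewrite mulmx1; exact/mulmx1C/unitarymxP.
    by apply/matrixP => i j; rewrite !mxE.
  by move=> i; rewrite mulfV// /y; case: ifP => //; rewrite oner_neq0.
rewrite mxrankMfree ?row_free_unit//.
apply/eqP; rewrite -(eqr_nat C) -tr_idempotent; last exact: (oproj_udiag_nat b uU).2.
rewrite tr_udiag// -natr_sum -sum1_card [in eqbRHS]big_mkcond /=.
by apply/eqP; congr _%:R; apply: eq_bigr => i _; rewrite inE /b; case: eqP.
Qed.

Lemma oproj_flag U m : U \is unitarymx -> oproj (flag U m).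
Proof. exact: oproj_udiag_nat. Qed.

Lemma rank_flag U m : U \is unitarymx -> (m <= n)%N -> \rank (flag U m) = m.
Proof.
move=> uU mn; rewrite rank_udiag// -sum1_card -[RHS]card_ord -sum1_card.
rewrite [RHS](big_ord_widen n (fun=> 1%N) mn); apply: eq_bigl => i.
by rewrite inE pnatr_eq0; case: ltnP.
Qed.

Lemma tr_flag U m : U \is unitarymx -> (m <= n)%N -> \tr (flag U m) = m%:R.
Proof.
by move=> uU mn; rewrite (tr_idempotent (oproj_flag m uU).2) rank_flag.
Qed.

Lemma tr_flag_udiag U x k : U \is unitarymx ->
  \tr (flag U k *m udiag U x) = \sum_(i < n | (i < k)%N) x i.
Proof.
move=> uU; rewrite /flag udiag_mul// tr_udiag// [RHS]big_mkcond /=.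
by apply: eq_bigr => i _; case: ifP; rewrite ?mul1r ?mul0r.
Qed.

(** Abel summation; for nonincreasing [g] the drops [g m - g m.+1] are the nonnegative weights of
    the flag projections. *)
Lemma telescope_tail (g : nat -> C) i : g n = 0 -> (i <= n)%N ->
  g i = \sum_(m < n) (g m - g m.+1) * (i < m.+1)%:R.
Proof.
move=> gn i_le.
have {1}<- : \sum_(i <= m < n) (g m - g m.+1) = g i.
  by rewrite (telescope_sumr_eq (fun m => - g m))// => [|m _];
    rewrite ?gn ?oppr0 ?sub0r ?opprK// addrC.
rewrite big_geq_mkord big_mkcond; apply: eq_bigr => m _ /=.
by rewrite ltnS; case: leqP; rewrite ?mulr1 ?mulr0.
Qed.

Lemma udiag_flag U (g : nat -> C) : g n = 0 ->
  udiag U (fun i => g i) = \sum_(m < n) (g m - g m.+1) *: flag U m.+1.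
Proof.
move=> gn; rewrite sum_udiag; apply: eq_udiag => i.
by apply: telescope_tail => //; exact: ltnW.
Qed.

(** The drop at [m] is counted once for each [i < k] with [i <= m], which produces the minimum of
    ranks in [tr_two_oproj]. *)
Lemma sum_telescope_tail (g : nat -> C) k : g n = 0 -> (k <= n)%N ->
  \sum_(i < k) g i = \sum_(m < n) (g m - g m.+1) * (minn k m.+1)%:R.
Proof.
move=> gn kn; transitivity
  (\sum_(i < k) \sum_(m < n) (g m - g m.+1) * (i < m.+1)%:R).
  by apply: eq_bigr => i _; apply: telescope_tail => //; apply: ltnW (leq_trans _ kn).
rewrite exchange_big; apply: eq_bigr => m _ /=; rewrite -mulr_sumr; congr (_ * _).
rewrite -natr_sum; congr _%:R.
elim: k {kn} => [|k IH]; first by rewrite big_ord0 min0n.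
by rewrite big_ord_recr /= IH; lia.
Qed.

(** * Ky Fan inequalities from pairs of flag projections *)

Section Majorization.
Variables (a b s : C).
Hypotheses (a0 : 0 <= a) (b0 : 0 <= b) (ab : a + b = 1).
Hypotheses (sR : s \is Num.real) (sab : s ^+ 2 <= a * b).

Let form A B := (a * \tr B) *: A + (b * \tr A) *: B - (s * 'i) *: commutator A B.

Lemma form_suml (I : Type) (r : seq I) (p : I -> C) (P : I -> 'M[C]_n) B :
  form (\sum_(m <- r) p m *: P m) B = \sum_(m <- r) p m *: form (P m) B.
Proof.
elim: r => [|m r IH].
  rewrite !big_nil /form /commutator mul0mx mulmx0 subrr mxtrace0 mulr0.
  by rewrite scale0r !scaler0 addr0 subr0.
rewrite !big_cons -IH; move: (\sum_(_ <- _) _) => A; rewrite /form /commutator.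
rewrite mulmxDl mulmxDr -scalemxAl -scalemxAr mxtraceD mxtraceZ.
move: (_ *m _) (_ *m _) (_ *m _) (_ *m _) => X1 X2 X3 X4.
by apply/matrixP => i j; rewrite !mxE; ring.
Qed.

Lemma form_sumr (I : Type) (r : seq I) (p : I -> C) (P : I -> 'M[C]_n) A :
  form A (\sum_(m <- r) p m *: P m) = \sum_(m <- r) p m *: form A (P m).
Proof.
elim: r => [|m r IH].
  rewrite !big_nil /form /commutator mul0mx mulmx0 subrr mxtrace0 mulr0.
  by rewrite scale0r !scaler0 addr0 subr0.
rewrite !big_cons -IH; move: (\sum_(_ <- _) _) => B; rewrite /form /commutator.
rewrite mulmxDl mulmxDr -scalemxAl -scalemxAr mxtraceD mxtraceZ.
move: (_ *m _) (_ *m _) (_ *m _) (_ *m _) => X1 X2 X3 X4.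
by apply/matrixP => i j; rewrite !mxE; ring.
Qed.

(** Both arguments are expanded along their flags and [tr_two_oproj] bounds each pair; the double
    sum of the bounds then factors. *)
Lemma tr_flag_form U V W (g h : nat -> C) k :
  U \is unitarymx -> V \is unitarymx -> W \is unitarymx ->
  (forall i, g i.+1 <= g i) -> (forall i, h i.+1 <= h i) -> g n = 0 -> h n = 0 ->
  \sum_(i < n) g i = 1 -> \sum_(i < n) h i = 1 -> (k <= n)%N ->
  \tr (flag W k *m form (udiag U (fun i => g i)) (udiag V (fun i => h i))) <=
  \sum_(i < k) (a * g i + b * h i).
Proof.
move=> uU uV uW gd hd gn hn g1 h1 kn.
(* Drops weighted by the ranks [m.+1] add up to the trace, so one factor of each product in the
   double sum is [1]. *)
have tail1 (f : nat -> C) : f n = 0 -> \sum_(i < n) f i = 1 ->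
    \sum_(m < n) (f m - f m.+1) * m.+1%:R = 1.
  move=> fn f1; rewrite -[RHS]f1 (sum_telescope_tail fn (leqnn n)).
  apply: eq_bigr => m _; by rewrite (minn_idPr (ltn_ord m)).
rewrite !udiag_flag// form_suml mulmx_sumr raddf_sum /=.
under eq_bigr do rewrite form_sumr -scalemxAr mulmx_sumr mxtraceZ raddf_sum /=.
under eq_bigr do under eq_bigr do rewrite -scalemxAr mxtraceZ.
rewrite big_split /= -!mulr_sumr !sum_telescope_tail//.
apply: (@le_trans _ _ (\sum_(m < n) (g m - g m.+1) * \sum_(l < n) (h l - h l.+1) *
   (a * l.+1%:R * (minn k m.+1)%:R + b * m.+1%:R * (minn k l.+1)%:R))).
  apply: ler_sum => m _; rewrite ler_wpM2l ?subr_ge0//.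
  apply: ler_sum => l _; rewrite ler_wpM2l ?subr_ge0//.
  have := tr_two_oproj (oproj_flag m.+1 uU) (oproj_flag l.+1 uV)
    (oproj_flag k uW) a0 b0 ab sR sab.
  by rewrite /form !rank_flag // !tr_flag.
rewrite [leLHS](_ : _ = a * (\sum_(m < n) (g m - g m.+1) * (minn k m.+1)%:R) + b * (\sum_(m < n) (h m - h m.+1) * (minn k m.+1)%:R))//.
transitivity (\sum_(m < n) (a * ((g m - g m.+1) * (minn k m.+1)%:R)
  * (\sum_(l < n) (h l - h l.+1) * l.+1%:R)
  + b * (\sum_(l < n) (h l - h l.+1) * (minn k l.+1)%:R)
      * ((g m - g m.+1) * m.+1%:R))).
  apply: eq_bigr => m _; rewrite !mulr_sumr mulr_suml -big_split /=.
  by apply: eq_bigr => l _; ring.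
by rewrite big_split /= -mulr_suml -mulr_sumr !tail1// !mulr1 -mulr_sumr tail1// mulr1.
Qed.
End Majorization.
End Flags.

(** * Majorization *)

Section Schur.
Variables (R : realFieldType) (n : nat).
Implicit Types (x y u v : 'rV[R]_n) (F : 'rV[R]_n -> R).

Definition nonneg_row v := forall i, 0 <= v 0 i.

Definition symmetric_fun F := forall (s : 'S_n) v, F (col_perm s v) = F v.

(** Concavity is asked only on the nonnegative orthant, where spectra of states lie;
    [boxplus_eigvals_ge0] exploits the freedom elsewhere. *)
Definition concave_nonneg F := forall (t : R) u v, 0 <= t <= 1 ->
  nonneg_row u -> nonneg_row v ->
  t * F u + (1 - t) * F v <= F (t *: u + (1 - t) *: v).

Definition nonincr_row x := forall i j : 'I_n, (i <= j)%N -> x 0 j <= x 0 i.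

Definition psum x (k : nat) := \sum_(i < n | (i < k)%N) x 0 i.

Lemma sum_delta (j : 'I_n) (P : pred 'I_n) :
  \sum_(i | P i) (i == j)%:R = (P j)%:R :> R.
Proof.
rewrite (eq_bigr (fun i => if i == j then 1 else 0)) => [|i _]; last by case: eqP.
rewrite -big_mkcondr /=; case: (boolP (P j)) => Pj.
  by rewrite (big_pred1 j)// => i /=; case: eqVneq => [->|]; rewrite ?Pj ?andbF.
by rewrite big_pred0// => i; case: eqVneq => [->|]; rewrite ?(negbTE Pj) ?andbF.
Qed.

(* Each step moves mass from an index [j] with [x_j < y_j] to the first index
   [k] with [y_k < x_k] until one of the two inequalities becomes an equality;
   the new vector is a convex combination of [y] and a transposition of [y]. *)
Lemma schur_concave_le F x y : symmetric_fun F -> concave_nonneg F ->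
  nonneg_row y -> nonincr_row x -> (forall k, psum x k <= psum y k) ->
  \sum_i x 0 i = \sum_i y 0 i -> F y <= F x.
Proof.
move=> symF concF; move: {2}_.+1 (ltnSn #|[pred i | x 0 i != y 0 i]|) => N.
elim: N y => [//|N IH] y; rewrite ltnS => leN y0 xd xy sxy.
have [/existsP[k0 yxk0]|] := boolP [exists k, y 0 k < x 0 k]; last first.
  rewrite negb_exists => /forallP yx.
  have {}yx i : 0 <= y 0 i - x 0 i by rewrite subr_ge0 leNgt yx.
  suff -> : x = y by [].
  apply/rowP => i; apply/esym/eqP; rewrite -subr_eq0.
  have /psumr_eq0P-> // : \sum_i (y 0 i - x 0 i) = 0.
  by rewrite sumrB sxy subrr.
case: (@arg_minnP _ k0 (fun k => y 0 k < x 0 k) (fun k : 'I_n => k : nat) yxk0) => k yxk kmin.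
have ltk (i : 'I_n) : (i < k)%N -> x 0 i <= y 0 i.
  by move=> ik; rewrite leNgt; apply/negP => /kmin; rewrite leqNgt ik.
(* Otherwise [y <= x] before [k] and strictly at [k], contradicting the partial sum up to and
   including [k]. *)
have [/existsP[j /andP[jk xyj]]|] :=
    boolP [exists j : 'I_n, (j < k)%N && (x 0 j < y 0 j)]; last first.
  rewrite negb_exists => /forallP noj; have := xy k.+1.
  rewrite /psum (bigD1 k)//= [leRHS](bigD1 k)//= leNgt ltr_leD//.
  apply: ler_sum => i /andP[ik nik]; move: (noj i).
  by rewrite ltn_neqAle nik -ltnS ik /= -leNgt.
pose d := Num.min (y 0 j - x 0 j) (x 0 k - y 0 k).
have d0 : 0 < d by rewrite lt_min !subr_gt0 xyj yxk.
have dj : d <= y 0 j - x 0 j by rewrite ge_min lexx.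
have dk : d <= x 0 k - y 0 k by rewrite ge_min lexx orbT.
have xjk : x 0 k <= x 0 j by apply/xd/ltnW.
have njk : (j == k) = false by apply/negbTE; rewrite neq_ltn jk.
have nkj : (k == j) = false by apply/negbTE; rewrite neq_ltn jk orbT.
pose y' : 'rV[R]_n := \row_i (y 0 i - d * (i == j)%:R + d * (i == k)%:R).
(* Weight [1 - t] on the transposition moves exactly [d] from [j] to [k]; the gap is positive since
   [y_k < x_k <= x_j < y_j]. *)
pose t := 1 - d / (y 0 j - y 0 k).
have yjk : 0 < y 0 j - y 0 k by lra.
have t01 : 0 <= t <= 1.
  rewrite /t subr_ge0 gerBl; apply/andP; split; last exact/divr_ge0/ltW/yjk/ltW.
  by rewrite ler_pdivrMr// mul1r; lra.
have y'E : y' = t *: y + (1 - t) *: col_perm (tperm j k) y.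
  apply/rowP => i; rewrite !mxE permE /= /t subKr.
  have [->|nij] := eqVneq i j.
    rewrite njk /=; field; exact: lt0r_neq0.
  have [->|nik] := eqVneq i k; last by rewrite /=; ring.
  by rewrite /=; field; exact: lt0r_neq0.
have y'0 : nonneg_row y'.
  move=> i; rewrite y'E !mxE; case/andP: t01 => t0 t1.
  by rewrite addr_ge0// mulr_ge0// ?y0// subr_ge0.
have psum' m : psum y' m = psum y m - d * (j < m)%N%:R + d * (k < m)%N%:R.
  rewrite /psum; under eq_bigr do rewrite mxE.
  rewrite 2!big_split /= sumrN -!mulr_sumr; congr (_ + _).
    by congr (_ - d * _); exact: (sum_delta j (fun i => (i < m)%N)).
  by congr (d * _); exact: (sum_delta k (fun i => (i < m)%N)).
have Fy' : F y <= F y'.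
  have := concF t y (col_perm (tperm j k) y) t01 y0.
  rewrite -y'E symF -mulrDl addrC subrK mul1r; apply=> i.
  by rewrite mxE.
apply: le_trans Fy' (IH y' _ y'0 xd _ _).
(* The coordinate attaining the minimum [d] now agrees, and those that agreed before are
   untouched. *)
- apply: leq_trans leN; apply/proper_card/properP; split.
    apply/fintype.subsetP => i; rewrite !inE mxE; apply: contraNN => /eqP xyi.
    have [ij|nij] := eqVneq i j; first by move: xyj; rewrite -ij xyi ltxx.
    have [ik|nik] := eqVneq i k; first by move: yxk; rewrite -ik xyi ltxx.
    by rewrite xyi mulr0 subr0 addr0.
  have [dE|dE] : d = y 0 j - x 0 j \/ d = x 0 k - y 0 k.
    by rewrite /d; case: leP; [left|right].
  exists j; first by rewrite !inE lt_eqF.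
  by rewrite !inE mxE eqxx njk dE /=; apply/negPn/eqP; ring.
  exists k; first by rewrite !inE gt_eqF.
  by rewrite !inE mxE eqxx nkj dE /=; apply/negPn/eqP; ring.
(* Partial sums change only for [j < m <= k]; there [x_j <= y_j - d], and the other indices below
   [m] satisfy [x_i <= y_i] by minimality of [k]. *)
- move=> m; rewrite psum'.
  have [jm|] := ltnP j m; last first.
    by move=> mj; rewrite ltnNge (leq_trans mj (ltnW jk)) !mulr0 subr0 addr0.
  have [km|mk] := ltnP k m; first by rewrite subrK.
  rewrite mulr1 mulr0 addr0 lerBrDr /psum.
  rewrite (bigD1 j)//= [leRHS](bigD1 j)//= addrAC lerD//; first by lra.
  by apply: ler_sum => i /andP[im _]; apply/ltk/(leq_trans im).
- have E (v : 'rV[R]_n) : \sum_i v 0 i = psum v n.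
    by rewrite /psum [RHS]big_mkcond; apply: eq_bigr => i _; rewrite ltn_ord.
  by rewrite sxy !E psum' !ltn_ord subrK.
Qed.
Lemma sort_row v : exists s : 'S_n, nonincr_row (col_perm s v).
Proof.
pose t := [tuple v 0 i | i < n].
have /tuple_permP[s st] : perm_eq (sort >=%R t) t by rewrite perm_sort.
exists s => i j ij.
have getv m : nth 0 (sort >=%R t) (val (m : 'I_n)) = col_perm s v 0 m.
  by rewrite st -tnth_nth !tnth_mktuple mxE.
rewrite -!getv; apply: (sorted_leq_nth (leT := >=%R)) => //.
- by move=> a b c /= ba /le_trans; apply.
- by move=> a; exact: lexx.
- by apply: sort_sorted => a b; exact: le_total.
- by rewrite inE size_sort size_tuple; exact: ltn_ord.
- by rewrite inE size_sort size_tuple; exact: ltn_ord.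
Qed.

Lemma psum_minn v k : psum v k = psum v (minn k n).
Proof. by apply: eq_bigl => i; rewrite ltn_min ltn_ord andbT. Qed.

Lemma psum_nat (g : nat -> R) v k : (forall i : 'I_n, g i = v 0 i) ->
  (k <= n)%N -> psum v k = \sum_(i < k) g i.
Proof.
by move=> gv kn; rewrite (big_ord_widen n g kn); apply: eq_bigr => i _; rewrite gv.
Qed.

End Schur.

(** * The spectrum of a sum *)

Section Spectrum.
Local Open Scope complex_scope.
Local Open Scope sesquilinear_scope.
Variables (R : realType) (n : nat).
Implicit Types (A : 'M[R[i]]_n).

(** Reordering the eigenvalues is absorbed by permuting the rows of the eigenvector matrix, so the
    spectrum may be taken sorted. *)
Lemma spectral_udiag A (s : 'S_n) : A \is hermsymmx ->
  exists2 U, U \is unitarymx &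
    A = udiag U (fun i => (col_perm s (eigvals A) 0 i)%:C).
Proof.
move=> hA; have uP := spectral_unitarymx A.
exists (row_perm s (spectralmx A)).
  apply/unitarymxP; rewrite tr_row_perm map_col_perm.
  rewrite row_permE col_permE mulmxA -[_ *m spectralmx A *m _]mulmxA.
  by rewrite (unitarymxP uP) mulmx1 -perm_mxM mulgV perm_mx1.
have /hermitian_normalmx /orthomx_spectralP {1}-> := hA.
rewrite invmx_unitary ?spectral_unitarymx// /udiag.
have spE : diag_mx (spectral_diag A) = diag_mx (\row_i (eigvals A 0 i)%:C).
  congr diag_mx; apply/rowP => i; rewrite !mxE RRe_real//.
  exact/mxOverP/hermitian_spectral_diag_real.
rewrite spE !mul_mx_diag.
apply/matrixP => i j; rewrite !mxE (reindex_inj (@perm_inj _ s)) /=.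
by apply: eq_bigr => k _; rewrite !mxE.
Qed.

(** The form evaluated at the [i]-th eigenvector is the [i]-th eigenvalue. *)
Lemma psdmx_eigvals_ge0 A : psdmx A -> nonneg_row (eigvals A).
Proof.
move=> [hA psdA] i; have [U uU AE] := spectral_udiag 1%g hA.
have := psdA ((row i U) ^t*); rewrite trmxCK.
have -> : (row i U *m A *m (row i U) ^t*) ord0 ord0 = (U *m A *m U ^t*) i i.
  by rewrite -row_mul [LHS]mxE [RHS]mxE; apply: eq_bigr => j _; rewrite !mxE.
have /unitarymxP uU' := uU.
rewrite {1}AE /udiag !mulmxA uU' mul1mx -mulmxA uU' mulmx1 !mxE eqxx perm1.
by rewrite lecR.
Qed.

Lemma trace_eigvals A : A \is hermsymmx ->
  \tr A = (\sum_i eigvals A 0 i)%:C.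
Proof.
move=> hA; have [U uU AE] := spectral_udiag 1%g hA.
rewrite {1}AE tr_udiag// rmorph_sum; apply: eq_bigr => i _.
by rewrite mxE perm1.
Qed.

Lemma hermsymmxP A : reflect (A ^t* = A) (A \is hermsymmx).
Proof.
apply: (iffP (is_hermitianmxP _ _ _)); rewrite expr0 scale1r => H; exact/esym.
Qed.

(** The commutator of Hermitian matrices is anti-Hermitian, and the factor [i] corrects this. *)
Lemma boxplus_herm a (rho sigma : 'M[R[i]]_n) : rho \is hermsymmx ->
  sigma \is hermsymmx -> boxplus a rho sigma \is hermsymmx.
Proof.
move=> /hermsymmxP h1 /hermsymmxP h2; apply/hermsymmxP.
have h12 : (rho *m sigma) ^t* = sigma *m rho by rewrite adj_mulmx h1 h2.
have h21 : (sigma *m rho) ^t* = rho *m sigma by rewrite adj_mulmx h1 h2.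
rewrite /boxplus complexiE; move: (rho *m sigma) (sigma *m rho) h12 h21 => P Q hP hQ.
have entry (A B : 'M[R[i]]_n) i j : A ^t* = B -> Num.conj (A j i) = B i j.
  by move=> <-; rewrite !mxE.
have realC (x : R) : Num.conj x%:C = x%:C by apply/CrealP; rewrite complex_real.
apply/matrixP => i j; rewrite !mxE !(rmorphD, rmorphN, rmorphM) /=.
rewrite !realC conjCi.
rewrite (entry _ _ _ _ h1) (entry _ _ _ _ h2) (entry _ _ _ _ hP) (entry _ _ _ _ hQ).
by ring.
Qed.

(** Symmetry allows all three spectra to be sorted. Concavity passes to the mixed spectrum, and
    Schur concavity to that of the sum, with Ky Fan's inequalities read on the flag of its
    eigenvectors. *)
Theorem symmetric_concave_boxplus (F : 'rV[R]_n -> R) a rho sigma :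
  symmetric_fun F -> concave_nonneg F -> density rho -> density sigma ->
  0 <= a <= 1 ->
  a * F (eigvals rho) + (1 - a) * F (eigvals sigma) <=
  F (eigvals (boxplus a rho sigma)).
Proof.
move=> symF concF [psd1 tr1] [psd2 tr2] a01.
set X := boxplus _ _ _.
have hX : X \is hermsymmx by apply: boxplus_herm; [exact: psd1.1|exact: psd2.1].
have [s1 d1] := sort_row (eigvals rho); have [s2 d2] := sort_row (eigvals sigma).
have [s3 d3] := sort_row (eigvals X).
rewrite -(symF s1 (eigvals rho)) -(symF s2 (eigvals sigma)) -(symF s3 (eigvals X)).
have [U uU rhoE] := spectral_udiag s1 psd1.1.
have [V uV sigE] := spectral_udiag s2 psd2.1.
have [W uW XE] := spectral_udiag s3 hX.
set l1 := col_perm s1 _ in d1 rhoE *; set l2 := col_perm s2 _ in d2 sigE *.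
set x := col_perm s3 _ in d3 XE *.
have l1_ge0 : nonneg_row l1 by move=> i; rewrite mxE psdmx_eigvals_ge0.
have l2_ge0 : nonneg_row l2 by move=> i; rewrite mxE psdmx_eigvals_ge0.
apply: le_trans (concF _ _ _ a01 l1_ge0 l2_ge0) _.
case/andP: (a01) => a0 a1; have b0 : 0 <= 1 - a by rewrite subr_ge0.
apply: (schur_concave_le symF concF) d3 _ _.
- by move=> i; rewrite mxE [X in X + _]mxE [X in _ + X]mxE addr_ge0 ?mulr_ge0.
- move=> k; rewrite psum_minn [leRHS]psum_minn.
  have := geq_minr k n; move: (minn k n) => {}k kn.
  (* Extension by zero supplies the [g n = 0] of the telescoping; it stays nonincreasing past the
     end because the entries are nonnegative. *)
  pose ext (v : 'rV[R]_n) (m : nat) := if insub m is Some i then v 0 i else 0.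
  have extE v (i : 'I_n) : ext v i = v 0 i by rewrite /ext valK.
  have extn v : ext v n = 0 by rewrite /ext insubF// ltnn.
  have ext_decr v m : nonneg_row v -> nonincr_row v -> ext v m.+1 <= ext v m.
    move=> v0 vd; rewrite /ext; case: insubP => [i _ im|].
      case: insubP => [j _ jm|]; first by rewrite vd// im jm.
      by rewrite -leqNgt => nm; have := ltn_ord i; rewrite im ltnNge leqW.
    by case: insubP => [j _ _ _|//]; exact: v0.
  have ext_sum (v : 'rV[R]_n) (A : 'M[R[i]]_n) (Z : 'M[R[i]]_n) : \tr A = 1 -> Z \is unitarymx ->
      A = udiag Z (fun i => (v 0 i)%:C) -> \sum_(i < n) (ext v i)%:C = 1.
    move=> trA uZ AE; rewrite -[RHS]trA AE tr_udiag//.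
    by apply: eq_bigr => i _; rewrite extE.
  have abC : a%:C + (1 - a)%:C = 1 by rewrite -rmorphD /= addrC subrK.
  have sabC : (Num.sqrt (a * (1 - a)))%:C ^+ 2 <= a%:C * (1 - a)%:C.
    by rewrite -rmorphXn sqr_sqrtr ?mulr_ge0// rmorphM.
  have sC : (Num.sqrt (a * (1 - a)))%:C \is Num.real by rewrite complex_real.
  have := tr_flag_form (g := fun m => (ext l1 m)%:C) (h := fun m => (ext l2 m)%:C)
    (k := k) _ _ abC sC sabC uU uV uW.
  rewrite !lecR !extn (ext_sum _ _ _ tr1 uU rhoE) (ext_sum _ _ _ tr2 uV sigE).
  have -> : udiag U (fun i => (ext l1 i)%:C) = rho.
    by rewrite rhoE; apply: eq_udiag => i; rewrite extE.
  have -> : udiag V (fun i => (ext l2 i)%:C) = sigma.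
    by rewrite sigE; apply: eq_udiag => i; rewrite extE.
  (* Unit traces turn the bilinear form into the addition rule, and the flag of [W] picks out the
     [k] largest eigenvalues of [X]. *)
  rewrite tr1 tr2 !mulr1 -complexiE -/(boxplus a rho sigma) -/X {1}XE tr_flag_udiag//.
  rewrite (psum_nat (v := a *: l1 + (1 - a) *: l2)
    (g := fun m => a * ext l1 m + (1 - a) * ext l2 m))//; last first.
    by move=> i; rewrite !extE [RHS]mxE; congr (_ + _); rewrite [RHS]mxE.
  have -> : \sum_(i < k) (a%:C * (ext l1 i)%:C + (1 - a)%:C * (ext l2 i)%:C) =
      (\sum_(i < k) (a * ext l1 i + (1 - a) * ext l2 i))%:C.
    rewrite rmorph_sum; apply: eq_bigr => i _.
    by rewrite [RHS]rmorphD; congr (_ + _); exact/esym/rmorphM.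
  rewrite -rmorph_sum lecR; apply => // m; rewrite lecR; exact: ext_decr.
- have sum_perm (s : 'S_n) (v : 'rV[R]_n) : \sum_i col_perm s v 0 i = \sum_i v 0 i :> R.
    rewrite [RHS](reindex_inj (@perm_inj _ s)).
    by apply: eq_bigr => i _; rewrite mxE.
  have sum1 A : A \is hermsymmx -> \tr A = 1 -> \sum_i eigvals A 0 i = 1.
    by move=> hA; rewrite trace_eigvals// => /complexI.
  rewrite sum_perm sum1//; last first.
    have comm0 : \tr (rho *m sigma - sigma *m rho) = 0.
      by rewrite mxtraceD -scaleN1r mxtraceZ mxtrace_mulC mulN1r subrr.
    rewrite /X /boxplus -scaleNr !mxtraceD !mxtraceZ comm0 tr1 tr2 mulr0 addr0.
    by rewrite !mulr1 -rmorphD /= addrC subrK.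
  under eq_bigr do rewrite mxE [X in X + _]mxE [X in _ + X]mxE.
  rewrite big_split /= -!mulr_sumr !sum_perm !sum1//; last 2 first.
  + exact: psd2.1.
  + exact: psd1.1.
  by rewrite !mulr1 addrC subrK.
Qed.

End Spectrum.

(** * Rényi entropies *)

Section Renyi.
Local Open Scope complex_scope.
Variables (R : realType) (n : nat).
Implicit Types (alpha t x y : R).

(** At [alpha = 0] this is the indicator of nonzero numbers, so that summing over eigenvalues gives
    the rank. *)
Definition rpow alpha x : R := if alpha == 0 then (x != 0)%:R else x `^ alpha.

Lemma rpow_ge0 alpha x : 0 <= rpow alpha x.
Proof. by rewrite /rpow; case: ifP => _; rewrite ?powR_ge0. Qed.

Lemma rpow_gt0 alpha x : 0 < x -> 0 < rpow alpha x.
Proof.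
by move=> x0; rewrite /rpow; case: ifP => _; rewrite ?powR_gt0// gt_eqF.
Qed.

Lemma rpow0 alpha : rpow alpha 0 = 0.
Proof. by rewrite /rpow; case: ifP => [_|/negbT a0]; rewrite ?eqxx// powR0. Qed.

Lemma powR_le_tangent alpha x : 0 < alpha < 1 -> 0 <= x ->
  x `^ alpha <= alpha * x + (1 - alpha).
Proof.
move=> /andP[a0 a1] x0; have b0 : 0 < 1 - alpha by rewrite subr_gt0.
have := @conjugate_powR R (x `^ alpha) 1 (alpha^-1) ((1 - alpha)^-1).
rewrite !invr_gt0 !invrK powR_ge0 ler01 powR1 mulr1 -powRrM divff ?gt_eqF//.
rewrite powRr1// mul1r [x * _]mulrC; apply => //; lra.
Qed.

(** Homogeneity carries the tangent at [1] to the tangent at [z]; for [alpha = 0] the right side is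
    the constant [1]. *)
Lemma rpow_tangent alpha x z : 0 <= alpha < 1 -> 0 < z -> 0 <= x ->
  rpow alpha x <= rpow alpha z * (1 + alpha * (x / z - 1)).
Proof.
move=> /andP[a0 a1] z0 x0; rewrite /rpow; case: eqP => [->|/eqP an0].
  by rewrite mul0r addr0 mulr1 (gt_eqF z0) lern1; case: eqP.
have a01 : 0 < alpha < 1 by rewrite lt_def an0 a0.
have xz : 0 <= x / z by rewrite divr_ge0// ltW.
have -> : x `^ alpha = z `^ alpha * (x / z) `^ alpha.
  by rewrite -(powRM _ (ltW z0) xz) [z * _]mulrC divfK// gt_eqF.
rewrite ler_wpM2l ?powR_ge0//; apply: le_trans (powR_le_tangent a01 xz) _.
by lra.
Qed.

(** Averaging the tangent bounds at the mean [z] cancels the slopes. *)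
Lemma rpow_concave alpha t x y : 0 <= alpha < 1 -> 0 <= t <= 1 ->
  0 <= x -> 0 <= y ->
  t * rpow alpha x + (1 - t) * rpow alpha y <= rpow alpha (t * x + (1 - t) * y).
Proof.
move=> a01 /andP[t0 t1] x0 y0; set z := t * x + (1 - t) * y.
have t1' : 0 <= 1 - t by rewrite subr_ge0.
have : 0 <= z by rewrite addr_ge0// mulr_ge0.
rewrite le_eqVlt => /predU1P[/esym/eqP|z0].
  (* At [z = 0] no tangent is available, but in each term the weight or the argument is zero. *)
  rewrite paddr_eq0 ?mulr_ge0// !mulf_eq0 => /andP[hx hy].
  have -> : t * rpow alpha x = 0.
    by case/orP: hx => /eqP ->; rewrite ?rpow0 ?mulr0 ?mul0r.
  have -> : (1 - t) * rpow alpha y = 0.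
    by case/orP: hy => /eqP ->; rewrite ?rpow0 ?mulr0 ?mul0r.
  by rewrite addr0 rpow_ge0.
apply: (@le_trans _ _ (rpow alpha z * (t * (1 + alpha * (x / z - 1)) +
   (1 - t) * (1 + alpha * (y / z - 1))))).
  rewrite mulrDr !(mulrCA (rpow alpha z)) lerD// ler_wpM2l// rpow_tangent//.
rewrite [X in _ * X](_ : _ = 1) ?mulr1//.
have zn0 : z != 0 by rewrite gt_eqF.
rewrite (_ : _ + _ = 1 + alpha * (z / z - 1)); last by rewrite {3}/z; field.
by rewrite divff// subrr mulr0 addr0.
Qed.

Lemma sum_rpow_concave alpha : 0 <= alpha < 1 ->
  concave_nonneg (fun v : 'rV[R]_n => \sum_i rpow alpha (v 0 i)).
Proof.
move=> a01 t u v t01 u0 v0; rewrite !mulr_sumr -big_split /=.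
apply: ler_sum => i _.
have -> : (t *: u + (1 - t) *: v) 0 i = t * u 0 i + (1 - t) * v 0 i by rewrite !mxE.
exact: rpow_concave.
Qed.

Lemma symmetric_sum (f : R -> R) : symmetric_fun (fun v : 'rV[R]_n => \sum_i f (v 0 i)).
Proof.
move=> s v; rewrite [RHS](reindex_inj (@perm_inj _ s)).
by apply: eq_bigr => i _; rewrite mxE.
Qed.

Lemma trace_powE alpha (rho : 'M[R[i]]_n) : rho \is hermsymmx ->
  trace_pow alpha rho = \sum_i rpow alpha (eigvals rho 0 i).
Proof.
move=> hA; rewrite /trace_pow /rpow; case: eqP => a0.
  have [U uU AE] := spectral_udiag 1%g hA.
  rewrite {1}AE rank_udiag// -sum1_card big_mkcond natr_sum.
  apply: eq_bigr => i _; rewrite inE mxE perm1 (inj_eq (@complexI R) _ 0).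
  by case: eqP.
rewrite /mxfun -mulmxA mxtrace_mulC -mulmxA mulmxV ?spectral_unit// mulmx1.
rewrite mxtrace_diag raddf_sum; apply: eq_bigr => i _; by rewrite !mxE.
Qed.

Lemma density_eigval_gt0 (rho : 'M[R[i]]_n) : density rho ->
  exists i, 0 < eigvals rho 0 i.
Proof.
move=> [psdr trr]; have l0 := psdmx_eigvals_ge0 psdr.
have /complexI s1 : (\sum_i eigvals rho 0 i)%:C = 1%:C :> R[i].
  by rewrite -trace_eigvals//; exact: psdr.1.
have [/existsP[i li]|] := boolP [exists i, 0 < eigvals rho 0 i]; first by exists i.
rewrite negb_exists => /forallP l_le0; move: s1; rewrite big1 => [/esym/eqP|i _].
  by rewrite oner_eq0.
by apply/le_anti; rewrite l0 leNgt l_le0.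
Qed.

Lemma trace_pow_gt0 alpha (rho : 'M[R[i]]_n) : density rho ->
  0 < trace_pow alpha rho.
Proof.
move=> dr; rewrite trace_powE; last exact: dr.1.1.
have [i li] := density_eigval_gt0 dr; rewrite (bigD1 i)//=.
by rewrite ltr_wpDr ?rpow_gt0// sumr_ge0// => j _; exact: rpow_ge0.
Qed.

Lemma ln_concave t x y : 0 <= t <= 1 -> 0 < x -> 0 < y ->
  t * ln x + (1 - t) * ln y <= ln (t * x + (1 - t) * y).
Proof.
move=> t01 x0 y0; have := @concave_ln R (Itv01 (andP t01).1 (andP t01).2) _ _ x0 y0.
exact.
Qed.

Lemma convex_comb_gt0 t x y : 0 <= t <= 1 -> 0 < x -> 0 < y ->
  0 < t * x + (1 - t) * y.
Proof.
move=> /andP[t0 t1] x0 y0; have [->|tn0] := eqVneq t 0.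
  by rewrite mul0r add0r subr0 mul1r.
by rewrite ltr_wpDr ?mulr_ge0 ?subr_ge0 ?(ltW y0)// mulr_gt0// lt_def tn0 t0.
Qed.

(** The positive factor [1 / (1 - alpha)] comes out; then [ln] is concave and increasing, and the
    trace of the power obeys the concavity inequality. *)
Theorem renyi_boxplus alpha a (rho sigma : 'M[R[i]]_n) : 0 <= alpha < 1 ->
  density rho -> density sigma -> 0 <= a <= 1 ->
  a * renyi alpha rho + (1 - a) * renyi alpha sigma
  <= renyi alpha (boxplus a rho sigma).
Proof.
move=> al01 dr ds a01; rewrite /renyi !(mulrCA _ (1 - alpha)^-1) -mulrDr.
case/andP: (al01) => al0 al1; case/andP: (a01) => a0 a1.
rewrite ler_wpM2l ?invr_ge0 ?subr_ge0 ?(ltW al1)//.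
have pr := trace_pow_gt0 alpha dr; have ps := trace_pow_gt0 alpha ds.
apply: le_trans (ln_concave a01 pr ps) _.
have hX : boxplus a rho sigma \is hermsymmx.
  by apply: boxplus_herm; [exact: dr.1.1|exact: ds.1.1].
have le_tr : a * trace_pow alpha rho + (1 - a) * trace_pow alpha sigma <=
    trace_pow alpha (boxplus a rho sigma).
  rewrite !trace_powE//; [|exact: ds.1.1|exact: dr.1.1].
  move: (symmetric_concave_boxplus (symmetric_sum (rpow alpha))
    (sum_rpow_concave al01) dr ds a01).
  move: (eigvals rho) (eigvals sigma) (eigvals (boxplus a rho sigma)) => u v w.
  move: (rpow alpha) => f. exact.
have := convex_comb_gt0 a01 pr ps.
move: (trace_pow alpha rho) (trace_pow alpha sigma) (trace_pow alpha (boxplus a rho sigma))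
  le_tr => u v w uvw uv0.
by rewrite ler_ln// posrE// (lt_le_trans uv0).
Qed.
End Renyi.

(** * Integrals over positive segments *)

Section PositiveIntegrals.
Local Open Scope classical_set_scope.
Variable R : realType.
Implicit Types (f g F : R -> R) (a b c : R).
Notation mu := (@lebesgue_measure R).

Definition continuous_pos f := forall x, 0 < x -> {for x, continuous f}.

Definition itvint f a b := (\int[mu]_(x in `[a, b]) f x)%R.

Lemma integrable_pos f a b : 0 < a -> continuous_pos f ->
  mu.-integrable `[a, b] (EFin \o f).
Proof.
move=> a0 cf; apply: continuous_compact_integrable; first exact: segment_compact.
apply: continuous_in_subspaceT => x; rewrite inE /= in_itv /= => /andP[ax _].
exact/cf/(lt_le_trans a0).
Qed.

Lemma itvint_ftc f F a b : 0 < a -> a <= b -> continuous_pos f ->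
  (forall x : R, 0 < x -> is_derive x 1 F (f x)) -> itvint f a b = F b - F a.
Proof.
move=> a0; rewrite le_eqVlt => /predU1P[->|ab] cf dF.
  by rewrite /itvint set_itv1 Rintegral_set1 subrr.
have cF (x : R) : 0 < x -> {for x, continuous F}.
  move=> x0; apply: differentiable_continuous; apply/derivable1_diffP.
  by have [] := dF x x0.
rewrite /itvint /Rintegral (@continuous_FTC2 _ f F)//.
- apply: continuous_in_subspaceT => x; rewrite inE /= in_itv /= => /andP[ax _].
  exact/cf/(lt_le_trans a0).
- split.
  + move=> x; rewrite in_itv /= => /andP[ax _].
    by have [] := dF x (lt_trans a0 ax).
  + by apply: cvg_at_right_filter; exact: cF.
  + by apply: cvg_at_left_filter; apply: cF (lt_trans a0 ab).
- move=> x; rewrite in_itv /= => /andP[ax _].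
  by rewrite derive1E; have [_ ->] := dF x (lt_trans a0 ax).
Qed.

Lemma itvint_cat f a b c : 0 < a -> a <= b -> b <= c -> continuous_pos f ->
  itvint f a c = itvint f a b + itvint f b c.
Proof.
move=> a0 ab bc cf; rewrite /itvint.
rewrite -(subrK (\int[mu]_(x in `[a, b]) f x)%R (\int[mu]_(x in `[a, c]) f x)%R) addrC.
congr (_ + _); rewrite Rintegral_itvB ?bnd_simp//; last exact: integrable_pos.
rewrite Rintegral_itv_obnd_cbnd//.
apply: (integrableS _ _ _ (integrable_pos c (lt_le_trans a0 ab) cf)) => //.
exact: subset_itv_oc_cc.
Qed.

Lemma itvint_le f g a b : 0 < a -> continuous_pos f -> continuous_pos g ->
  (forall x, a <= x <= b -> f x <= g x) -> itvint f a b <= itvint g a b.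
Proof.
move=> a0 cf cg fg; apply: le_Rintegral => //; exact: integrable_pos.
Qed.

Lemma continuous_posD f g : continuous_pos f -> continuous_pos g ->
  continuous_pos (fun x => f x + g x).
Proof. by move=> cf cg x x0; apply: cvgD; [exact: cf|exact: cg]. Qed.

Lemma continuous_posZ k f : continuous_pos f -> continuous_pos (fun x => k * f x).
Proof. by move=> cf x x0; apply: cvgMl_tmp; exact: cf. Qed.

Lemma itvintD f g a b : 0 < a -> continuous_pos f -> continuous_pos g ->
  itvint (fun x => f x + g x) a b = itvint f a b + itvint g a b.
Proof. by move=> a0 cf cg; apply: RintegralD => //; exact: integrable_pos. Qed.

Lemma itvintZ k f a b : 0 < a -> continuous_pos f ->
  itvint (fun x => k * f x) a b = k * itvint f a b.
Proof. by move=> a0 cf; apply: RintegralZl => //; exact: integrable_pos. Qed.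

Lemma continuous_pos_inv : continuous_pos (fun x => x^-1).
Proof. by move=> x x0; apply: inv_continuous; rewrite gt_eqF. Qed.

Lemma continuous_pos_cst k : continuous_pos (fun=> k).
Proof. by move=> x x0; exact: cst_continuous. Qed.

Lemma itvint_inv a b : 0 < a -> a <= b ->
  itvint (fun x => x^-1) a b = ln b - ln a.
Proof.
move=> a0 ab; apply: itvint_ftc => //; exact: continuous_pos_inv.
Qed.

Lemma itvint_cst k a b : 0 < a -> a <= b -> itvint (fun=> k) a b = k * (b - a).
Proof.
move=> a0 ab; rewrite mulrBr; apply: (itvint_ftc (F := fun x => k * x)) => //.
  exact: continuous_pos_cst.
move=> x x0; by apply: is_derive_eq; rewrite /GRing.scale /= mulr1.
Qed.

Lemma itvint_inv2 a b : 0 < a -> a <= b ->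
  itvint (fun x => x^-1 ^+ 2) a b = a^-1 - b^-1.
Proof.
move=> a0 ab; rewrite -[a^-1]opprK addrC; apply: (itvint_ftc (F := fun x => - x^-1)) => //.
- move=> x x0; apply: (@continuous_comp _ _ _ (@GRing.inv R) (fun y => y ^+ 2)).
    by apply: inv_continuous; rewrite gt_eqF.
  exact: exprn_continuous.
- move=> x x0; have xn0 : x != 0 by rewrite gt_eqF.
  have dV : is_derive x 1 (@GRing.inv R) (- x ^- 2 *: 1).
    exact: (@is_deriveV _ id x 1 1).
  by apply: is_derive_eq; rewrite /GRing.scale /= mulr1 opprK exprVn.
Qed.
End PositiveIntegrals.

(** * Lagrange interpolation *)

Section Lagrange.
Variables (K : fieldType) (d : nat) (x : 'I_d -> K).
Hypothesis x_inj : injective x.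

Let weight (i : 'I_d) := \prod_(j < d | j != i) (x i - x j).

Let node (i : 'I_d) : {poly K} := \prod_(j < d | j != i) ('X - (x j)%:P).

Let weight_neq0 i : weight i != 0.
Proof.
apply/prodf_neq0 => j ji; rewrite subr_eq0; apply: contraNneq ji => xij.
by rewrite (x_inj xij).
Qed.

Let p : {poly K} := \prod_(i < d) ('X - (x i)%:P).

Let size_p : size p = d.+1.
Proof. by rewrite size_prod_XsubC [index_enum _]unlock -enumT size_enum_ord. Qed.

Let node_monic i : node i \is monic. Proof. exact: monic_prod_XsubC. Qed.

Let size_node i : size (node i) = d.
Proof.
have := size_p; rewrite /p (bigD1 i)//= size_monicM ?monicXsubC ?monic_neq0//.
  by rewrite size_XsubC => -[].
exact: node_monic.
Qed.

Let node_sample i k : (node i).[x k] = (i == k)%:R * weight i.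
Proof.
rewrite /node horner_prod; have [<-|ik] := eqVneq i k.
  by rewrite mul1r; apply: eq_bigr => j _; rewrite hornerXsubC.
by rewrite (bigD1 k) 1?eq_sym//= hornerXsubC subrr !mul0r.
Qed.

(** The difference has size at most [d] and vanishes at [d] distinct points. *)
Lemma lagrange_interpolation (r : {poly K}) : (size r <= d)%N ->
  r = \sum_i (r.[x i] / weight i) *: node i.
Proof.
move=> szr; apply/eqP; rewrite -subr_eq0; apply/eqP.
apply: (@roots_geq_poly_eq0 _ _ [seq x i | i <- enum 'I_d]).
- apply/allP => _ /mapP[k _ ->]; rewrite /root hornerD hornerN horner_sum.
  rewrite (bigD1 k)//= big1 => [|i ik]; last first.
    by rewrite hornerZ node_sample (negbTE ik) mul0r mulr0.
  by rewrite hornerZ node_sample eqxx mul1r addr0 divfK ?weight_neq0// subrr.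
- by rewrite map_inj_uniq ?enum_uniq.
- rewrite size_map size_enum_ord (leq_trans (size_polyD _ _))// geq_max szr/=.
  rewrite size_polyN (leq_trans (size_sum _ _ _))//; apply/bigmax_leqP => i _.
  by rewrite (leq_trans (size_scale_leq _ _))// size_node.
Qed.

(** The remainder of ['X^d] modulo [p]: it has size at most [d] and agrees with ['X^d] at the
    nodes. *)
Let r : {poly K} := 'X^d - p.

Let size_r : (size r <= d)%N.
Proof.
apply/leq_sizeP => j; rewrite coefB coefXn leq_eqVlt => /predU1P[<-|dj].
  have : lead_coef p = 1 by exact: lead_coef_prod_XsubC.
  by rewrite lead_coefE size_p /= eqxx => ->; rewrite subrr.
by rewrite gtn_eqF// nth_default ?size_p// subrr.
Qed.

Let r_sample i : r.[x i] = x i ^+ d.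
Proof.
by rewrite hornerD hornerN hornerXn horner_prod (bigD1 i)//= hornerXsubC subrr
  mul0r subr0.
Qed.

(** Partial fractions: the interpolation formula for [r] is evaluated at [- t] and divided by
    [p.[- t]]. *)
Lemma sum_lagrange_inv (t : K) : (forall i, t + x i != 0) ->
  \sum_i x i ^+ d / weight i / (t + x i) = 1 - \prod_i (t / (t + x i)).
Proof.
move=> tx0; have := congr1 (fun q => q.[- t]) (lagrange_interpolation size_r).
have tx0' i : - t - x i != 0 by rewrite -opprD oppr_eq0.
have pt0 : p.[- t] != 0.
  by rewrite horner_prod; apply/prodf_neq0 => i _; rewrite hornerXsubC.
have nodeE i : (node i).[- t] = - (p.[- t] / (t + x i)).
  rewrite /p /node !horner_prod [in RHS](bigD1 i)//= hornerXsubC.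
  by rewrite -[- t - x i]opprD; field.
rewrite horner_sum (eq_bigr (fun i => x i ^+ d / weight i * - (p.[- t] / (t + x i)))); last first.
  by move=> i _; rewrite hornerZ r_sample nodeE.
rewrite hornerD hornerN hornerXn => /(congr1 (fun u => - u / p.[- t])).
have -> : \prod_i (t / (t + x i)) = (- t) ^+ d / p.[- t].
  rewrite horner_prod -[X in _ ^+ X]card_ord -prodr_const -prodf_div.
  by apply: eq_bigr => i _; rewrite hornerXsubC -opprD invrN mulrNN.
rewrite opprB mulrBl divff// => ->.
rewrite -sumrN mulr_suml; apply: eq_bigr => i _.
by field; rewrite pt0 tx0 weight_neq0.
Qed.

(** Comparison of the coefficients of degree [d - 1] in the interpolation of [r], every node
    polynomial being monic of that degree. *)
Lemma sum_lagrange_top : (0 < d)%N ->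
  \sum_i x i ^+ d / weight i = \sum_i x i.
Proof.
move=> d0; have := congr1 (fun q : {poly K} => q`_d.-1) (lagrange_interpolation size_r).
rewrite coef_sum coefB coefXn ltn_eqF ?sub0r ?prednK//.
have -> : p`_d.-1 = - \sum_i x i.
  have <- : \prod_(y <- [seq x i | i <- enum 'I_d]) ('X - y%:P) = p.
    by rewrite big_map big_enum.
  have := @coefPn_prod_XsubC K [seq x i | i <- enum 'I_d].
  rewrite size_map size_enum_ord -lt0n => /(_ d0) ->.
  by rewrite big_map big_enum.
rewrite opprK => ->; apply: eq_bigr => i _.
rewrite coefZ r_sample; have /monicP := node_monic i.
by rewrite lead_coefE size_node => ->; rewrite mulr1.
Qed.
End Lagrange.

(** * Subentropy *)

Section Resolvent.
Local Open Scope classical_set_scope.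
Variables (R : realType) (d : nat).
Implicit Types (l u v : 'rV[R]_d) (s t : R).

Definition row_sum l := \sum_i l 0 i.

(** For the spectrum [l] of a state [rho] this is the determinant of [t (t + rho)^-1]. *)
Definition resolvent_prod l t := \prod_i (t / (t + l 0 i)).

Lemma row_sum_ge0 l : nonneg_row l -> 0 <= row_sum l.
Proof. by move=> l0; apply: sumr_ge0. Qed.

Lemma resolvent_bounds t x : 0 <= x -> 0 < t -> 0 <= t / (t + x) <= 1.
Proof.
move=> x0 t0; have tx : 0 < t + x by rewrite ltr_wpDr.
by rewrite divr_ge0 ?(ltW t0) ?(ltW tx)//= ler_pdivrMr// mul1r lerDl.
Qed.

Lemma resolvent_prod_bounds l t : nonneg_row l -> 0 < t ->
  0 <= resolvent_prod l t <= 1.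
Proof.
move=> l0 t0; rewrite /resolvent_prod.
elim/big_ind: _ => [|x y /andP[x0 x1] /andP[y0 y1]|i _]; first by rewrite ler01 lexx.
  by rewrite mulr_ge0//= mulr_ile1.
exact: resolvent_bounds.
Qed.

(** Each factor is at least [1 - l_i / t]; as all partial products lie in [[0, 1]], the defects add
    up. *)
Lemma resolvent_prod_ge l t : nonneg_row l -> 0 < t ->
  1 - row_sum l / t <= resolvent_prod l t.
Proof.
move=> l0 t0; rewrite /resolvent_prod /row_sum mulr_suml.
pose K (x y : R) : Prop := (1 - x <= y) && (0 <= y <= 1).
suff: K (\sum_i l 0 i / t) (\prod_i (t / (t + l 0 i))) by case/andP.
apply: (big_rec2 K) => [|i y1 y2 _ /andP[h1 /andP[h2 h3]]]; rewrite /K.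
  by rewrite subr0 lexx ler01.
have /andP[a0 a1] := resolvent_bounds (l0 i) t0.
have al : 1 - l 0 i / t <= t / (t + l 0 i).
  have tn0 : t != 0 by rewrite gt_eqF.
  rewrite ler_pdivlMr ?ltr_wpDr// -subr_ge0.
  have -> : t - (1 - l 0 i / t) * (t + l 0 i) = (l 0 i) ^+ 2 / t by field.
  by rewrite divr_ge0 ?sqr_ge0// ltW.
move: (t / (t + l 0 i)) (l 0 i / t) a0 a1 al => a v a0 a1 al.
by apply/andP; split; [nra|apply/andP; split; nra].
Qed.

(** The inverse product is at least [1 + U], and [(1 + U) (1 - U + U^2) = 1 + U^3 >= 1]. *)
Lemma resolvent_prod_le l t : nonneg_row l -> 0 < t ->
  resolvent_prod l t <= 1 - row_sum l / t + (row_sum l / t) ^+ 2.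
Proof.
move=> l0 t0; set U := row_sum l / t.
have U0 : 0 <= U by rewrite divr_ge0 ?row_sum_ge0// ltW.
have le1U : 1 + U <= \prod_i (1 + l 0 i / t).
  rewrite /U /row_sum mulr_suml.
  pose K (x y : R) : Prop := (1 + x <= y) && (0 <= x).
  suff: K (\sum_i l 0 i / t) (\prod_i (1 + l 0 i / t)) by case/andP.
  apply: (big_rec2 K) => [|i y1 y2 _ /andP[h1 h2]]; rewrite /K; first by rewrite addr0 !lexx.
  have lt0 : 0 <= l 0 i / t by rewrite divr_ge0// ltW.
  rewrite addr_ge0// andbT.
  apply: (@le_trans _ _ ((1 + l 0 i / t) * (1 + y1))); first by nra.
  by rewrite ler_wpM2l// addr_ge0.
have -> : resolvent_prod l t = (\prod_i (1 + l 0 i / t))^-1.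
  rewrite /resolvent_prod -prodfV; apply: eq_bigr => i _.
  have tl : t + l 0 i != 0 by rewrite gt_eqF// ltr_wpDr.
  have tn0 : t != 0 by rewrite gt_eqF.
  by field; rewrite tl tn0.
have U1 : 0 < 1 + U by rewrite ltr_wpDr.
apply: (@le_trans _ _ (1 + U)^-1).
  by rewrite lef_pV2// posrE (lt_le_trans U1).
rewrite -[leLHS]mul1r ler_pdivrMr//.
have : 0 <= U ^+ 3 by rewrite exprn_ge0.
by rewrite !exprS expr0; nra.
Qed.

(** Factors are exchanged one at a time; all lie in [[0, 1]], so the errors add. *)
Lemma resolvent_prod_lipschitz u v t : nonneg_row u -> nonneg_row v -> 0 < t ->
  resolvent_prod u t <= resolvent_prod v t + (\sum_i `|u 0 i - v 0 i|) / t.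
Proof.
move=> u0 v0 t0; rewrite /resolvent_prod mulr_suml.
pose K (x y z : R) : Prop := (x <= y + z) && ((0 <= y <= 1) && (0 <= z)).
suff: K (\prod_i (t / (t + u 0 i))) (\prod_i (t / (t + v 0 i)))
  (\sum_i `|u 0 i - v 0 i| / t) by case/andP.
apply: (big_rec3 K) => [|i x y D _ /andP[h1 /andP[/andP[h2 h3] h4]]]; rewrite /K.
  by rewrite addr0 lexx ler01 lexx.
have /andP[a0 a1] := resolvent_bounds (u0 i) t0.
have /andP[b0 b1] := resolvent_bounds (v0 i) t0.
have ab : t / (t + u 0 i) <= t / (t + v 0 i) + `|u 0 i - v 0 i| / t.
  have tu : 0 < t + u 0 i by rewrite ltr_wpDr.
  have tv : 0 < t + v 0 i by rewrite ltr_wpDr.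
  (* Scalar resolvent identity. *)
  have -> : t / (t + u 0 i) = t / (t + v 0 i)
      + (v 0 i - u 0 i) / t * ((t / (t + u 0 i)) * (t / (t + v 0 i))).
    by field; rewrite !gt_eqF.
  rewrite lerD2l; apply: (@le_trans _ _ (`|u 0 i - v 0 i| / t *
    (t / (t + u 0 i) * (t / (t + v 0 i))))).
    apply: ler_wpM2r; first exact: mulr_ge0.
    by rewrite ler_wpM2r ?invr_ge0 ?(ltW t0)// distrC ler_norm.
  by rewrite ler_piMr ?divr_ge0 ?(ltW t0)// mulr_ile1.
have d0 : 0 <= `|u 0 i - v 0 i| / t by rewrite divr_ge0// ltW.
move: (t / (t + u 0 i)) (t / (t + v 0 i)) (`|u 0 i - v 0 i| / t) a0 a1 b0 b1 ab d0.
move=> p q e a0 a1 b0 b1 ab d0.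
by apply/andP; split; [nra|apply/andP; split; [apply/andP; split; nra|nra]].
Qed.

(** The logarithm is a sum of convex terms [ln t - ln (t + w_i)], and [expR] is increasing and
    convex. *)
Lemma resolvent_prod_convex s u v t : 0 <= s <= 1 ->
  nonneg_row u -> nonneg_row v -> 0 < t ->
  resolvent_prod (s *: u + (1 - s) *: v) t <=
  s * resolvent_prod u t + (1 - s) * resolvent_prod v t.
Proof.
move=> s01 u0 v0 t0; have /andP[s0 s1] := s01.
have s1' : 0 <= 1 - s by rewrite subr_ge0.
pose L (w : 'rV[R]_d) := \sum_i (ln t - ln (t + w 0 i)) : R.
have rE w : nonneg_row w -> resolvent_prod w t = expR (L w).
  move=> w0; rewrite expR_sum; apply: eq_bigr => i _.
  by rewrite expRD expRN !lnK// posrE ltr_wpDr.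
have z0 : nonneg_row (s *: u + (1 - s) *: v).
  by move=> i; rewrite !mxE addr_ge0// mulr_ge0.
rewrite !rE//; apply: (@le_trans _ _ (expR (s * L u + (1 - s) * L v))).
  rewrite ler_expR /L !mulr_sumr -big_split; apply: ler_sum => i _ /=.
  have tu : 0 < t + u 0 i by rewrite ltr_wpDr.
  have tv : 0 < t + v 0 i by rewrite ltr_wpDr.
  have := ln_concave s01 tu tv.
  rewrite !mxE; have -> : s * (t + u 0 i) + (1 - s) * (t + v 0 i) =
    t + (s * u 0 i + (1 - s) * v 0 i) by ring.
  by lra.
exact: (@convex_expR R (Itv01 s0 s1) (L u) (L v)).
Qed.

Lemma continuous_resolvent_prod l : nonneg_row l ->
  continuous_pos (resolvent_prod l).
Proof.
move=> l0 x x0; rewrite /resolvent_prod.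
apply: cvg_big => [|i _]; first exact: mul_continuous.
apply: cvgM; first exact: cvg_id.
apply: cvgV; first by rewrite gt_eqF// ltr_wpDr.
by apply: cvgD; [exact: cvg_id|exact: cvg_cst].
Qed.

Lemma symmetric_resolvent_prod t : symmetric_fun (resolvent_prod^~ t).
Proof.
move=> s v; rewrite /resolvent_prod [RHS](reindex_inj (@perm_inj _ s)).
by apply: eq_bigr => i _; rewrite mxE.
Qed.

End Resolvent.

(** * Truncations of the integral for the subentropy *)

Section TruncatedSubentropy.
Local Open Scope classical_set_scope.
Variables (R : realType) (d : nat).
Implicit Types (l u v : 'rV[R]_d) (s t : R) (N : nat).

Definition cutoff N : R := N.+1%:R.

(** Written as a sum with a scalar multiple to match [continuous_posD] and [continuous_posZ]. *)
Definition co_resolvent l t := 1 + -1 * resolvent_prod l t.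

(** The subtracted term is the exact integral of [row_sum l / (1 + t)] from [1 / T] to [T], with
    [T = cutoff N]. *)
Definition truncated_subentropy N l : R :=
  itvint (co_resolvent l) (cutoff N)^-1 (cutoff N) - row_sum l * ln (cutoff N).

Lemma cutoff_gt0 N : 0 < cutoff N. Proof. by rewrite ltr0n. Qed.

Lemma cutoff_ge1 N : 1 <= cutoff N. Proof. by rewrite ler1n. Qed.

Lemma cutoffV_gt0 N : 0 < (cutoff N)^-1. Proof. by rewrite invr_gt0 cutoff_gt0. Qed.

Lemma cutoffV_le N : (cutoff N)^-1 <= cutoff N.
Proof. by rewrite (le_trans _ (cutoff_ge1 N))// invf_le1 ?cutoff_gt0 ?cutoff_ge1. Qed.

Lemma ln_cutoff_ge0 N : 0 <= ln (cutoff N). Proof. by rewrite ln_ge0 ?cutoff_ge1. Qed.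

Lemma cutoff_le N m : (N <= m)%N -> cutoff N <= cutoff m.
Proof. by move=> Nm; rewrite ler_nat ltnS. Qed.

Lemma continuous_co_resolvent l : nonneg_row l -> continuous_pos (co_resolvent l).
Proof.
move=> l0; apply: continuous_posD; first exact: continuous_pos_cst.
exact/continuous_posZ/continuous_resolvent_prod.
Qed.

(** Near zero the integrand lies in [[0, 1]]; near infinity it lies between [S / t - S^2 / t^2] and
    [S / t], with [S = row_sum l], and the logarithm absorbs [S / t]. *)
Lemma truncated_subentropy_step N m l : nonneg_row l -> (N <= m)%N ->
  - (row_sum l ^+ 2 / cutoff N) <= truncated_subentropy m l - truncated_subentropy N l
  <= (cutoff N)^-1 - (cutoff m)^-1.
Proof.
move=> l0 Nm; have cf := continuous_co_resolvent l0.
have S0 := row_sum_ge0 l0.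
have TT' := cutoff_le Nm; have T0 := cutoff_gt0 N; have T0' := cutoff_gt0 m.
have e0' := cutoffV_gt0 m; have e0 := cutoffV_gt0 N.
have ee' : (cutoff m)^-1 <= (cutoff N)^-1 by rewrite lef_pV2// posrE.
have eT := cutoffV_le N.
have -> : truncated_subentropy m l - truncated_subentropy N l =
    itvint (co_resolvent l) (cutoff m)^-1 (cutoff N)^-1 +
    (itvint (co_resolvent l) (cutoff N) (cutoff m) - row_sum l * (ln (cutoff m) - ln (cutoff N))).
  rewrite /truncated_subentropy (itvint_cat e0' ee' (le_trans eT TT') cf).
  by rewrite (itvint_cat e0 eT TT' cf); ring.
have low : 0 <= itvint (co_resolvent l) (cutoff m)^-1 (cutoff N)^-1 <= (cutoff N)^-1 - (cutoff m)^-1.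
  have := itvint_cst 0 e0' ee'; have := itvint_cst 1 e0' ee'.
  rewrite mul0r mul1r => c1 c0; apply/andP; split.
    rewrite -c0; apply: itvint_le => //; first exact: continuous_pos_cst.
    move=> x /andP[ex _]; have x0 := lt_le_trans e0' ex.
    by have /andP[_ g1] := resolvent_prod_bounds l0 x0; rewrite /co_resolvent; lra.
  rewrite -c1; apply: itvint_le => //; first exact: continuous_pos_cst.
  move=> x /andP[ex _]; have x0 := lt_le_trans e0' ex.
  by have /andP[g0 _] := resolvent_prod_bounds l0 x0; rewrite /co_resolvent; lra.
have cfi : continuous_pos (fun x : R => row_sum l * x^-1).
  exact/continuous_posZ/continuous_pos_inv.
have cfi2 : continuous_pos (fun x : R => - row_sum l ^+ 2 * x^-1 ^+ 2).
  apply: continuous_posZ => x x0.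
  apply: (@continuous_comp _ _ _ (@GRing.inv R) (fun y => y ^+ 2)).
    exact: continuous_pos_inv.
  exact: exprn_continuous.
have up : itvint (co_resolvent l) (cutoff N) (cutoff m) <= row_sum l * (ln (cutoff m) - ln (cutoff N)).
  rewrite -itvint_inv// -itvintZ//; last exact: continuous_pos_inv.
  apply: itvint_le => // x /andP[ex _]; have x0 := lt_le_trans T0 ex.
  by have := resolvent_prod_ge l0 x0; rewrite /co_resolvent; lra.
have dn : row_sum l * (ln (cutoff m) - ln (cutoff N)) +
    - row_sum l ^+ 2 * ((cutoff N)^-1 - (cutoff m)^-1) <= itvint (co_resolvent l) (cutoff N) (cutoff m).
  rewrite -itvint_inv// -itvint_inv2// -itvintZ//; last exact: continuous_pos_inv.
  rewrite -[X in _ + X <= _]itvintZ//; last first.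
    move=> x x0; apply: (@continuous_comp _ _ _ (@GRing.inv R) (fun y => y ^+ 2)).
      exact: continuous_pos_inv.
    exact: exprn_continuous.
  rewrite -itvintD//; apply: itvint_le => //; first exact: continuous_posD.
  move=> x /andP[ex _]; have x0 := lt_le_trans T0 ex.
  by have := resolvent_prod_le l0 x0; rewrite /co_resolvent exprMn; lra.
have S2 : 0 <= row_sum l ^+ 2 * (cutoff m)^-1 by rewrite mulr_ge0 ?sqr_ge0// ltW.
case/andP: low S2 dn up; move: (itvint _ _ _) (itvint _ _ _) (row_sum l) => A B S.
move: (ln (cutoff m) - ln (cutoff N)) ((cutoff N)^-1) ((cutoff m)^-1) => L e e' A0 A1 S2 dn up.
by apply/andP; split; nra.
Qed.

(** In the factor [3], two come from integrating [1 / t] over [[1 / T, T]] and one from the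
    subtracted row sum. *)
Lemma truncated_subentropy_lipschitz N u v : nonneg_row u -> nonneg_row v ->
  truncated_subentropy N u <= truncated_subentropy N v
    + (\sum_i `|u 0 i - v 0 i|) * (3 * ln (cutoff N)).
Proof.
move=> u0 v0; set D := \sum_i _; have D0 : 0 <= D by exact: sumr_ge0.
have e0 := cutoffV_gt0 N; have eT := cutoffV_le N; have L0 := ln_cutoff_ge0 N.
have cu := continuous_co_resolvent u0; have cv := continuous_co_resolvent v0.
have ci : continuous_pos (fun x : R => D * x^-1).
  exact/continuous_posZ/continuous_pos_inv.
have int_le : itvint (co_resolvent u) (cutoff N)^-1 (cutoff N) <=
    itvint (co_resolvent v) (cutoff N)^-1 (cutoff N) + D * (ln (cutoff N) - ln (cutoff N)^-1).
  rewrite -itvint_inv// -itvintZ//; last exact: continuous_pos_inv.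
  rewrite -itvintD//; apply: itvint_le => //; first exact: continuous_posD.
  move=> x /andP[ex _]; have x0 := lt_le_trans e0 ex.
  have := resolvent_prod_lipschitz v0 u0 x0.
  under eq_bigr do rewrite distrC.
  by rewrite -/D /co_resolvent; lra.
have tot : row_sum v - row_sum u <= D.
  rewrite /row_sum -sumrB; apply: ler_sum => i _.
  by rewrite distrC ler_norm.
move: int_le; rewrite lnV ?posrE ?cutoff_gt0// /truncated_subentropy.
have : (row_sum v - row_sum u) * ln (cutoff N) <= D * ln (cutoff N) by rewrite ler_wpM2r.
by lra.
Qed.

Lemma truncated_subentropy_concave N : concave_nonneg (truncated_subentropy N).
Proof.
move=> s u v s01 u0 v0; have /andP[s0 s1] := s01.
have e0 := cutoffV_gt0 N; have eT := cutoffV_le N.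
have z0 : nonneg_row (s *: u + (1 - s) *: v).
  by move=> i; rewrite !mxE addr_ge0// mulr_ge0// subr_ge0.
have cu := continuous_co_resolvent u0; have cv := continuous_co_resolvent v0.
have cz := continuous_co_resolvent z0.
have tot : row_sum (s *: u + (1 - s) *: v) = s * row_sum u + (1 - s) * row_sum v.
  rewrite /row_sum !mulr_sumr -big_split; apply: eq_bigr => i _; by rewrite !mxE.
rewrite /truncated_subentropy tot.
have : s * itvint (co_resolvent u) (cutoff N)^-1 (cutoff N) +
   (1 - s) * itvint (co_resolvent v) (cutoff N)^-1 (cutoff N) <=
   itvint (co_resolvent (s *: u + (1 - s) *: v)) (cutoff N)^-1 (cutoff N).
  rewrite -!itvintZ// -itvintD//; try exact: continuous_posZ.
  apply: itvint_le => //; first by apply: continuous_posD; exact: continuous_posZ.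
  move=> x /andP[ex _]; have x0 := lt_le_trans e0 ex.
  by have := resolvent_prod_convex s01 u0 v0 x0; rewrite /co_resolvent; lra.
by lra.
Qed.

Lemma symmetric_truncated_subentropy N : symmetric_fun (truncated_subentropy N).
Proof.
move=> s v; rewrite /truncated_subentropy /row_sum (symmetric_sum id).
congr (itvint _ _ _ - _); apply/funext => t.
by rewrite /co_resolvent symmetric_resolvent_prod.
Qed.

End TruncatedSubentropy.

(** * Partial fractions and the limit of the truncations *)

Section Subentropy.
Local Open Scope classical_set_scope.
Variables (R : realType) (d : nat).
Hypothesis d_gt0 : (0 < d)%N.
Implicit Types (l u v : 'rV[R]_d) (s t : R) (N : nat).

Let weight l i := l 0 i ^+ d / \prod_(j < d | j != i) (l 0 i - l 0 j).

Lemma distinct_pos_nonneg l : distinct_pos l -> nonneg_row l.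
Proof. by move=> [_ l0] i; exact/ltW/l0. Qed.

(** [sum_lagrange_inv] splits the integrand into simple fractions, with logarithms as
    antiderivatives. *)
Lemma itvint_co_resolvent l a b : distinct_pos l -> 0 < a -> a <= b ->
  itvint (co_resolvent l) a b =
  \sum_i weight l i * ln (b + l 0 i) - \sum_i weight l i * ln (a + l 0 i).
Proof.
move=> dl a0 ab; have l0 := distinct_pos_nonneg dl.
apply: (itvint_ftc (F := fun x => \sum_i weight l i * ln (x + l 0 i))) => //.
  exact: continuous_co_resolvent.
move=> x x0; have xl i : 0 < x + l 0 i by rewrite ltr_wpDr.
have -> : co_resolvent l x = \sum_i weight l i / (x + l 0 i).
  rewrite /co_resolvent mulN1r /resolvent_prod.
  rewrite -(sum_lagrange_inv (x := fun i => l 0 i))//; first exact: dl.1.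
  by move=> i; rewrite gt_eqF.
have dF i : is_derive x 1 (fun y => weight l i * ln (y + l 0 i)) (weight l i / (x + l 0 i)).
  have dln := is_derive1_ln (xl i).
  have h : is_derive x 1 (fun y : R => ln (y + l 0 i)) ((x + l 0 i)^-1 * 1).
    have dg : is_derive x 1 (fun y : R => y + l 0 i) 1.
      by apply: is_derive_eq; rewrite addr0.
    exact: (@is_derive1_comp _ (@ln R) (fun y : R => y + l 0 i) x _ _ dln dg).
  by apply: is_derive_eq; rewrite mulr1.
have -> : (fun y => \sum_i weight l i * ln (y + l 0 i)) =
    \sum_(i < d) (fun y => weight l i * ln (y + l 0 i)).
  by apply/funext => y; rewrite fct_sumE.
exact: is_derive_sum.
Qed.

(** The weights add up to [row_sum l] by [sum_lagrange_top], so the divergence at the upper end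
    cancels; the lower end yields [ln l_i]. *)
Lemma truncated_subentropy_cvg l : distinct_pos l ->
  truncated_subentropy N l @[N --> \oo] --> subentropy_formula l.
Proof.
move=> dl; have l0 := distinct_pos_nonneg dl.
have E N : truncated_subentropy N l =
   \sum_i (weight l i * (ln (1 + (cutoff R N)^-1 * l 0 i) - ln ((cutoff R N)^-1 + l 0 i))).
  have T0 := cutoff_gt0 R N.
  rewrite /truncated_subentropy itvint_co_resolvent ?cutoffV_gt0 ?cutoffV_le//.
  rewrite /row_sum -(sum_lagrange_top (x := fun i => l 0 i) dl.1)//.
  rewrite mulr_suml -!sumrB; apply: eq_bigr => i _.
  have -> : 1 + (cutoff R N)^-1 * l 0 i = (cutoff R N + l 0 i) / cutoff R N.
    by field; rewrite gt_eqF.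
  rewrite ln_div ?posrE ?ltr_wpDr// /weight; ring.
have h0 : (cutoff R N)^-1 @[N --> \oo] --> (0 : R) by exact: cvg_harmonic.
rewrite (_ : (fun N => _) = fun N => \sum_i (weight l i * (ln (1 + (cutoff R N)^-1 * l 0 i) - ln ((cutoff R N)^-1 + l 0 i)))); last first.
  by apply/funext => N; rewrite E.
rewrite /subentropy_formula -sumrN.
have -> : \sum_i - (l 0 i ^+ d / \prod_(j < d | j != i) (l 0 i - l 0 j) * ln (l 0 i))
   = \sum_i (weight l i * (ln (1 + 0 * l 0 i) - ln (0 + l 0 i))).
  by apply: eq_bigr => i _; rewrite mul0r addr0 ln1 !add0r mulrN.
apply: cvg_big => [|i _]; first exact: add_continuous.
 apply: cvgMl_tmp; apply: cvgB.
  apply: continuous_cvg; first by apply: continuous_ln; rewrite mul0r addr0.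
  by apply: cvgD; [exact: cvg_cst|exact: cvgMr_tmp].
apply: continuous_cvg; first by apply: continuous_ln; rewrite add0r; exact: dl.2.
by apply: cvgD => //; exact: cvg_cst.
Qed.

(** Adding [1 / cutoff R N] makes the sequence nonincreasing, by the upper step bound; the lower one
    bounds it from below. *)
Lemma truncated_subentropy_is_cvg l : nonneg_row l ->
  cvgn (fun N => truncated_subentropy N l).
Proof.
move=> l0; have Vcvg : (cutoff R N)^-1 @[N --> \oo] --> (0 : R) by exact: cvg_harmonic.
have : cvgn (fun N => truncated_subentropy N l + (cutoff R N)^-1).
  apply: nonincreasing_is_cvgn.
    move=> N m Nm; have /andP[_] := truncated_subentropy_step l0 Nm; by move: (cutoff R N)^-1 (cutoff R m)^-1 => e e' ?; lra.
  exists (truncated_subentropy 0 l - row_sum l ^+ 2) => _ [N _ <-].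
  have /andP[+ _] := truncated_subentropy_step l0 (leq0n N).
  rewrite [cutoff R 0]/cutoff divr1; have := cutoffV_gt0 R N.
  by move: (cutoff R N)^-1 => e e0 ?; lra.
move=> h; have -> : (fun N => truncated_subentropy N l) =
  (fun N => truncated_subentropy N l + (cutoff R N)^-1) \- (fun N => (cutoff R N)^-1).
  by apply/funext => N /=; rewrite addrK.
by apply: is_cvgB => //; apply/cvg_ex; exists 0.
Qed.

Definition subentropy_ext l : R := limn (fun N => truncated_subentropy N l).

(** Limit in [m] of the step bounds; the rate is uniform on sets of bounded row sum, which gives
    continuity. *)
Lemma subentropy_ext_approx N l : nonneg_row l ->
  `|subentropy_ext l - truncated_subentropy N l| <= (row_sum l ^+ 2 + 1) / cutoff R N.
Proof.
move=> l0; have h := truncated_subentropy_is_cvg l0.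
have T0 := cutoffV_gt0 R N.
have S0 : 0 <= row_sum l ^+ 2 / cutoff R N by rewrite divr_ge0 ?sqr_ge0// ltW ?cutoff_gt0.
rewrite mulrDl mul1r ler_norml; apply/andP; split.
  rewrite lerBrDr; apply: limr_ge => //; exists N => // m /= Nm.
  have /andP[+ _] := truncated_subentropy_step l0 Nm.
  by move: (cutoff R N)^-1 (_ / cutoff R N) T0 => e e' ? ?; lra.
rewrite lerBlDr; apply: limr_le => //; exists N => // m /= Nm.
have /andP[_] := truncated_subentropy_step l0 Nm; have := cutoffV_gt0 R m.
by move: (cutoff R m)^-1 (cutoff R N)^-1 (_ / cutoff R N) S0 => e e' e'' ? ? ?; lra.
Qed.

Lemma subentropy_ext_formula l : distinct_pos l ->
  subentropy_ext l = subentropy_formula l.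
Proof. by move=> dl; apply/cvg_lim/truncated_subentropy_cvg. Qed.

Lemma symmetric_subentropy_ext : symmetric_fun subentropy_ext.
Proof.
move=> s v; rewrite /subentropy_ext; congr (limn _); apply/funext => N.
exact: symmetric_truncated_subentropy.
Qed.

Lemma subentropy_ext_concave : concave_nonneg subentropy_ext.
Proof.
move=> s u v s01 u0 v0; have /andP[s0 s1] := s01.
have z0 : nonneg_row (s *: u + (1 - s) *: v).
  by move=> i; rewrite !mxE addr_ge0// mulr_ge0// subr_ge0.
have hu := truncated_subentropy_is_cvg u0; have hv := truncated_subentropy_is_cvg v0.
have hz := truncated_subentropy_is_cvg z0.
apply: (ler_cvg_to (f := fun N => s * truncated_subentropy N u + (1 - s) * truncated_subentropy N v)
  _ hz).
  by apply: cvgD; exact: cvgMl_tmp.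
by near=> N; exact: truncated_subentropy_concave.
Unshelve. all: by end_near. Qed.
End Subentropy.

(** * Continuous extension to coinciding and zero eigenvalues *)

Section SubentropyExtension.
Local Open Scope classical_set_scope.
Variables (R : realType) (d : nat).
Hypothesis d_gt0 : (0 < d)%N.
Implicit Types (l u v : 'rV[R]_d) (s t : R) (N : nat).

(** Shifting entry [i] by [k (i + 1)] separates equal entries and makes all positive, while a small
    [k] keeps distinct entries apart. *)
Lemma closure_distinct_pos l : nonneg_row l -> closure (@distinct_pos R d) l.
Proof.
move=> l0 B /nbhs_ballP[e /= e0 ballB].
pose m := \big[Num.min/e]_(p : 'I_d * 'I_d | l 0 p.1 != l 0 p.2) `|l 0 p.1 - l 0 p.2|.
have m0 : 0 < m.
  by apply: lt_bigmin => // p lp; rewrite normr_gt0 subr_eq0.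
have dR : 0 < d%:R + 1 :> R by rewrite ltr_wpDl.
pose k := m / (d%:R + 1) / 2.
have k0 : 0 < k by rewrite !divr_gt0.
have kd : k * (d%:R + 1) < m.
  have -> : k * (d%:R + 1) = m / 2 by rewrite /k; field; rewrite gt_eqF.
  by lra.
pose u : 'rV[R]_d := \row_i (l 0 i + k * i.+1%:R).
have ule (i : 'I_d) : (i.+1%:R : R) <= d%:R + 1.
  by rewrite -natr1 lerD2r ler_nat ltnW.
exists u; split.
  split=> [i j|i]; last by rewrite mxE ltr_wpDl// mulr_gt0.
  rewrite !mxE => uij; apply/val_inj; apply/eqP.
  have [lij|lij] := eqVneq (l 0 i) (l 0 j).
    move: uij; rewrite lij => /addrI /(mulfI (lt0r_neq0 k0)) /eqP.
    by rewrite eqr_nat eqSS.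
  have : m <= `|l 0 i - l 0 j| by apply: (@bigmin_le_cond _ _ _ _ (i, j)).
  have -> : l 0 i - l 0 j = k * (j.+1%:R - i.+1%:R) by lra.
  rewrite normrM gtr0_norm// leNgt => /negP[]; apply: le_lt_trans kd.
  rewrite ler_wpM2l ?(ltW k0)// ler_norml.
  have := ule i; have := ule j.
  have : (0 : R) <= i.+1%:R by []. have : (0 : R) <= j.+1%:R by [].
  by move=> *; apply/andP; split; lra.
apply: ballB; split=> // i0 i; rewrite (ord1 i0) /ball /= mxE.
rewrite opprD addNKr normrN gtr0_norm ?mulr_gt0//.
apply: le_lt_trans (lt_le_trans kd _); first by rewrite ler_wpM2l ?(ltW k0).
exact: bigmin_le_id.
Qed.

Lemma row_sum_le l u : row_sum u <= row_sum l + \sum_i `|u 0 i - l 0 i|.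
Proof.
rewrite /row_sum -big_split; apply: ler_sum => i _ /=.
by have := ler_norm (u 0 i - l 0 i); lra.
Qed.

Lemma subentropy_ext_continuous l (eps : R) : nonneg_row l -> 0 < eps ->
  exists2 delta : R, 0 < delta & forall u, nonneg_row u ->
    \sum_i `|u 0 i - l 0 i| < delta ->
    `|subentropy_ext l - subentropy_ext u| < eps.
Proof.
move=> l0 eps0; pose B := row_sum l + 1.
have B0 : 0 <= B by rewrite addr_ge0// row_sum_ge0.
have [N hN] : exists N, (B ^+ 2 + 1) / cutoff R N < eps / 3.
  pose x := (B ^+ 2 + 1) / (eps / 3); exists (Num.truncn x).
  have x0 : 0 <= x by rewrite divr_ge0 ?addr_ge0 ?sqr_ge0// divr_ge0// ltW.
  rewrite ltr_pdivrMr ?cutoff_gt0// mulrC -ltr_pdivrMr ?divr_gt0//.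
  by rewrite /cutoff real_truncnS_gt ?num_real.
have L0 := ln_cutoff_ge0 R N.
have K0 : 0 < 3 * ln (cutoff R N) + 1 by rewrite ltr_wpDl// mulr_ge0.
exists (Num.min 1 (eps / 3 / (3 * ln (cutoff R N) + 1))).
  by rewrite lt_min ltr01 !divr_gt0.
move=> u u0; set D := \sum_i _; rewrite lt_min => /andP[D1 DN].
have D0 : 0 <= D by exact: sumr_ge0.
have approx v : nonneg_row v -> row_sum v <= B ->
    `|subentropy_ext v - truncated_subentropy N v| < eps / 3.
  move=> v0 vB; apply: le_lt_trans (subentropy_ext_approx N v0) (le_lt_trans _ hN).
  rewrite ler_pM2r ?cutoffV_gt0// lerD2r ler_sqr ?nnegrE//; exact: row_sum_ge0.
have lB : row_sum l <= B by rewrite lerDl.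
have uB : row_sum u <= B by apply: le_trans (row_sum_le l u) _; rewrite lerD2l ltW.
have DL : D * (3 * ln (cutoff R N)) < eps / 3.
  apply: (@le_lt_trans _ _ (D * (3 * ln (cutoff R N) + 1))); first by nra.
  by rewrite -ltr_pdivlMr.
have := truncated_subentropy_lipschitz N u0 l0.
have := truncated_subentropy_lipschitz N l0 u0.
under eq_bigr do rewrite distrC.
rewrite -/D; have := approx _ l0 lB; have := approx _ u0 uB.
rewrite !ltr_norml => /andP[? ?] /andP[? ?] ? ?.
by apply/andP; split; lra.
Qed.

Lemma subentropy_vecE l : nonneg_row l -> subentropy_vec l = subentropy_ext l.
Proof.
move=> l0; rewrite /subentropy_vec; case: asboolP => dl.
  by rewrite subentropy_ext_formula.
have PF : ProperFilter (within (@distinct_pos R d) (nbhs l)).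
  by apply: within_nbhs_proper; exact: closure_distinct_pos.
apply/cvg_lim => //; apply/cvgrPdist_lt => eps eps0.
have [delta delta0 hd] := subentropy_ext_continuous l0 eps0.
have dR : 0 < d%:R :> R by rewrite ltr0n.
apply/nbhs_ballP; exists (delta / 2 / d%:R); first by rewrite /= !divr_gt0.
move=> u [_ lu] du; rewrite -subentropy_ext_formula//.
apply: hd; first exact: distinct_pos_nonneg.
apply: (@le_lt_trans _ _ (\sum_(i < d) (delta / 2 / d%:R))).
  by apply: ler_sum => i _; rewrite distrC; exact/ltW/lu.
rewrite sumr_const card_ord -[_ *+ d]mulr_natr divfK ?gt_eqF//; lra.
Qed.
End SubentropyExtension.

(* The test function vanishes on nonnegative vectors, so its concavity there
   is trivial, while at the spectrum of the sum it is minus the negative part. *)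
Lemma boxplus_eigvals_ge0 (R : realType) (d : nat) a (rho sigma : 'M[R[i]%C]_d) :
  density rho -> density sigma -> 0 <= a <= 1 ->
  nonneg_row (eigvals (boxplus a rho sigma)).
Proof.
move=> dr ds a01; pose f (x : R) := Num.min x 0.
have f0 v : nonneg_row v -> \sum_(i < d) f (v 0 i) = 0.
  by move=> v0; rewrite big1// => i _; rewrite /f min_r.
have concF : concave_nonneg (fun v : 'rV[R]_d => \sum_i f (v 0 i)).
  move=> t u v /andP[t0 t1] u0 v0; rewrite !f0 ?mulr0 ?addr0//.
  by move=> i; rewrite !mxE addr_ge0// mulr_ge0// subr_ge0.
have := symmetric_concave_boxplus (symmetric_sum f) concF dr ds a01.
rewrite f0; last exact: psdmx_eigvals_ge0 dr.1.
rewrite f0; last exact: psdmx_eigvals_ge0 ds.1.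
rewrite !mulr0 addr0; move: (eigvals _) => x sum0 i.
have fle j : f (x 0 j) <= 0 by rewrite /f ge_min lexx orbT.
have : 0 <= f (x 0 i).
  apply: le_trans sum0 _; rewrite (bigD1 i)//= gerDl.
  by apply: sumr_le0.
by rewrite /f le_min lexx andbT.
Qed.

Theorem subentropy_boxplus (R : realType) (d : nat) a (rho sigma : 'M[R[i]%C]_d) :
  (0 < d)%N -> density rho -> density sigma -> 0 <= a <= 1 ->
  a * subentropy rho + (1 - a) * subentropy sigma <= subentropy (boxplus a rho sigma).
Proof.
move=> d0 dr ds a01; rewrite /subentropy.
rewrite !subentropy_vecE//; [|exact: boxplus_eigvals_ge0|exact: psdmx_eigvals_ge0 ds.1|
  exact: psdmx_eigvals_ge0 dr.1].
exact: (symmetric_concave_boxplus (@symmetric_subentropy_ext R d)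
  (@subentropy_ext_concave R d) dr ds a01).
Qed.

Unset Implicit Arguments.
Local Open Scope complex_scope.

Theorem mainTheorem4 (R : realType) (d : nat) (d_ge1 : (1 <= d)%N)
    (rho sigma : 'M[R[i]]_d) (a : R) (rho_density : density rho)
    (sigma_density : density sigma) (a_itv : 0 <= a <= 1) :
  (forall alpha : R, 0 <= alpha < 1 ->
     renyi alpha (boxplus a rho sigma) >=
       a * renyi alpha rho + (1 - a) * renyi alpha sigma) /\
  subentropy (boxplus a rho sigma) >=
    a * subentropy rho + (1 - a) * subentropy sigma.
Proof.
split=> [alpha alpha_itv|]; first exact: renyi_boxplus.
exact: subentropy_boxplus.
Qed.
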